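(* Let $(\mathbf{X}_t)_{t\in\mathbb{Z}}$ be a causal $K$-dimensional VAR(1) process $\mathbf{X}_t=\mathbf{\Phi}\mathbf{X}_{t-1}+\mathbf{Z}_t$. Assume that the errors $\mathbf{Z}_t$ are (multivariate) normally distributed and that $\mathbf{\Gamma}_0:=\operatorname{cov}(\mathbf{X}_t,\mathbf{X}_t)$ has full rank. Then the process is time-reversible: there are a matrix $\widetilde{\mathbf{\Phi}}\in\mathbb{R}^{K\times K}$ and an i.i.d. noise sequence $(\widetilde{\mathbf{Z}}_t)_{t\in\mathbb{Z}}$ such that for all $t$ $$\mathbf{X}_t=\widetilde{\mathbf{\Phi}}\mathbf{X}_{t+1}+\widetilde{\mathbf{Z}}_t,$$ where for all $i>t$, $\widetilde{\mathbf{Z}}_t$ is independent of $\mathbf{X}_i$.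
   Context: A $K$-dimensional VAR(1) process is a weakly stationary $\mathbb{R}^K$-valued time series $(\mathbf{X}_t)_{t\in\mathbb{Z}}$ for which there are a matrix $\mathbf{\Phi}\in\mathbb{R}^{K\times K}$ and an i.i.d. white noise sequence $(\mathbf{Z}_t)_{t\in\mathbb{Z}}$ (i.i.d., zero mean, finite second moments) with $\mathbf{X}_t=\mathbf{\Phi}\mathbf{X}_{t-1}+\mathbf{Z}_t$ for all $t$. Weakly stationary means that the mean is constant in time and that the covariance between $\mathbf{X}_t$ and $\mathbf{X}_{t+h}$ depends only on the lag $h\in\mathbb{Z}$. The process is causal if there is a sequence of matrices $\mathbf{\Psi}_0,\mathbf{\Psi}_1,\ldots$ with absolutely summable components such that $\mathbf{X}_t=\sum_{j=0}^\infty\mathbf{\Psi}_j\mathbf{Z}_{t-j}$ for all $t$. *)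

(* Defs.v *)
From HB Require Import structures.
From mathcomp Require Import all_boot all_order all_algebra finmap.
From mathcomp Require Import all_classical all_reals all_analysis.

Set Implicit Arguments.
Unset Strict Implicit.
Unset Printing Implicit Defensive.

Import Order.TTheory GRing.Theory Num.Theory.
Import numFieldNormedType.Exports.

Local Open Scope classical_set_scope.
Local Open Scope ring_scope.

(* Identities between random vectors, and convergence of series of random
   vectors, are understood almost surely. *)

Section random_vectors.
Context {d : measure_display} {T : measurableType d} {R : realType}.
Context {K : nat}.
Variable P : probability T R.
Implicit Types X Y : T -> 'cV[R]_K.

Definition component X (i : 'I_K) : T -> R := fun w => X w i 0.

(* The Borel sigma-algebra of R^K, as the product sigma-algebra. *)
Definition borel_cV : set (set 'cV[R]_K) :=
  g_sigma_preimage (fun (i : 'I_K) (v : 'cV[R]_K) => v i 0).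

(* Membership in [Lfun] includes measurability of the components. *)
Definition square_integrable X : Prop :=
  forall i, component X i \in Lfun P 2%:E.

Definition mean_vec X : 'cV[R]_K :=
  \col_i fine ('E_P[component X i])%E.

Definition cov_mx X Y : 'M[R]_K :=
  \matrix_(i, j) fine (covariance P (component X i) (component Y j)).

Definition indep_vec X Y : Prop :=
  forall A B, borel_cV A -> borel_cV B ->
    P (X @^-1` A `&` Y @^-1` B) = (P (X @^-1` A) * P (Y @^-1` B))%E.

Definition mutually_indep {I : choiceType} (Z : I -> T -> 'cV[R]_K) : Prop :=
  forall (J : {fset I}) (B : I -> set 'cV[R]_K),
    (forall t, t \in J -> borel_cV (B t)) ->
    P (\bigcap_(t in [set` J]) (Z t @^-1` B t)) =
    (\prod_(t <- J) P (Z t @^-1` B t))%E.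

Definition identically_distributed {I : Type} (Z : I -> T -> 'cV[R]_K) :
    Prop :=
  forall s t B, borel_cV B -> P (Z s @^-1` B) = P (Z t @^-1` B).

(* The univariate law N(m, s^2); [normal_prob] is the intended law only for
   [s != 0], and the degenerate law is the point mass at [m]. *)
Definition normal_law (m s : R) (B : set R) : \bar R :=
  if s == 0 then \d_m B else normal_prob m s B.

(* Possibly singular: every linear functional of [X] is normal. *)
Definition multivariate_normal X : Prop :=
  forall a : 'rV[R]_K, exists m s : R, forall B : set R, measurable B ->
    P ((fun w => (a *m X w) 0 0) @^-1` B) = normal_law m s B.

End random_vectors.

Section processes.
Context {d : measure_display} {T : measurableType d} {R : realType}.
Context {K : nat}.
Variable P : probability T R.
Implicit Types X Z : int -> T -> 'cV[R]_K.

Definition weakly_stationary X : Prop :=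
  [/\ forall t, square_integrable P (X t),
      forall s t, mean_vec P (X s) = mean_vec P (X t) &
      forall s t h, cov_mx P (X s) (X (s + h)) = cov_mx P (X t) (X (t + h))].

Definition iid_white_noise Z : Prop :=
  [/\ mutually_indep P Z,
      identically_distributed P Z,
      forall t, square_integrable P (Z t) &
      forall t, mean_vec P (Z t) = 0].

Definition VAR1 (Phi : 'M[R]_K) X Z : Prop :=
  [/\ weakly_stationary X,
      iid_white_noise Z &
      forall t, {ae P, forall w, X t w = Phi *m X (t - 1) w + Z t w}].

Definition causal X Z : Prop :=
  exists Psi : nat -> 'M[R]_K,
    (forall i j, cvgn (series (fun n => `|Psi n i j|))) /\
    (forall t, {ae P, forall w,
       series (fun j => Psi j *m Z (t - j%:Z) w) @ \oo --> X t w}).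

End processes.

(* Main.v *)
Require Import Defs.
From HB Require Import structures.
From mathcomp Require Import all_boot all_order all_algebra finmap.
From mathcomp Require Import all_classical all_reals all_analysis.
From mathcomp Require Import measurable_realfun ring lra zify.

Set Implicit Arguments.
Unset Strict Implicit.
Unset Printing Implicit Defensive.

Import Order.TTheory GRing.Theory Num.Theory.
Import numFieldNormedType.Exports.

Local Open Scope classical_set_scope.
Local Open Scope ring_scope.

(** The reversed coefficient is the linear regression of X_t on X_(t+1): with
    Gamma1 = cov(X_t, X_(t+1)), put Phi' = Gamma1 Gamma0^-1 and let
    Z'_t = X_t - Phi' X_(t+1) be the residual.  The residual is uncorrelated
    with X_(t+1) because the normal equations hold, and it is uncorrelated with
    X_(t+1+h) by induction on h: X_(t+2+h) = Phi X_(t+1+h) + Z_(t+2+h), and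
    causality makes the innovation Z_(t+2+h) uncorrelated with everything that
    is built from earlier innovations, in particular with Z'_t.  For s > t the
    residual Z'_s is a combination of X_s and X_(s+1), so Z'_t is uncorrelated
    with Z'_s as well.  Stationarity gives all Z'_t the same covariance.

    It remains to pass from uncorrelated to independent, and from equal
    covariances to equal laws.  Everything takes place in one Gaussian Hilbert
    space, the closure [closed_span] of the finite linear combinations of the
    Z_t under almost sure limits in L2.  A variable L is called [gaussian] when
    E cos(u L + th) = cos th exp(- u^2 E(L^2) / 2) for all u and th; the phase
    th records the real and the imaginary part of the characteristic function
    at once, and the factor cos th says that L is centred.

    - [Rintegral_cos_normal_pdf] computes the characteristic function of a
      normal density, through the differential equation that it satisfies.
    - [lincomb_copies] and [gaussian_add]: a sum of independent gaussian
      variables is gaussian, and independent ones are orthogonal.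
    - [gaussian_lim]: almost sure limits in L2 of gaussian variables are
      gaussian, and second moments converge along the way.  This is what turns
      the series of the causal representation into orthogonality relations.
    - [same_law]: two random elements with the same trigonometric moments have
      the same law.  Applied to a vector on T and to its independent copies on
      T * T it gives [gaussian_orth_indep]: orthogonal gaussian families are
      independent.

    Mutual independence of the residuals then follows by peeling off the
    earliest time of a finite set: that residual is orthogonal to all the
    others. *)

(** * Integrals against a probability *)

Section tools.
Context {d : measure_display} {T : measurableType d} {R : realType}.

Lemma dominated_cvg_Rintegral (mu : {measure set T -> \bar R})
    (f_ : nat -> T -> R) (f g : T -> R) :
  (forall n, measurable_fun setT (f_ n)) -> measurable_fun setT f ->
  {ae mu, forall w, f_ ^~ w @ \oo --> f w} ->
  mu.-integrable setT (EFin \o g) ->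
  (forall n w, `|f_ n w| <= g w) ->
  \int[mu]_w f_ n w @[n --> \oo] --> \int[mu]_w f w.
Proof.
move=> mf_ mf cf ig fg.
have [||||iF _ cI] := @dominated_convergence _ _ _ mu setT measurableT
  (fun n w => (f_ n w)%:E) (EFin \o f) (EFin \o g) _ _ _ ig.
- by move=> n; exact/measurable_EFinP.
- exact/measurable_EFinP.
- by apply: filterS cf => w cw _; apply: cvg_EFin => //; exact: nearW.
- by apply: aeW => w n _ /=; rewrite lee_fin.
apply: fine_cvg => /=.
rewrite fineK; last exact: integrable_fin_num.
exact: cI.
Qed.

Section probability.
Variable P : probability T R.

Lemma bounded_integrable (f : T -> R) (M : R) :
  measurable_fun setT f -> (forall w, `|f w| <= M) ->
  P.-integrable setT (EFin \o f).
Proof.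
move=> mf fM; apply: measurable_bounded_integrable => //.
  by rewrite (le_lt_trans (probability_le1 _ _))// ltry.
exists M; split; first exact: num_real.
by move=> x Mx w _ /=; rewrite (le_trans (fM w))// ltW.
Qed.

Lemma bounded_cvg_Rintegral (f_ : nat -> T -> R) (f : T -> R) (M : R) :
  (forall n, measurable_fun setT (f_ n)) -> measurable_fun setT f ->
  {ae P, forall w, f_ ^~ w @ \oo --> f w} ->
  (forall n w, `|f_ n w| <= M) ->
  \int[P]_w f_ n w @[n --> \oo] --> \int[P]_w f w.
Proof.
move=> mf_ mf cf fM; apply: (@dominated_cvg_Rintegral P f_ f (cst M)) => //.
exact: finite_measure_integrable_cst.
Qed.

Lemma ae_eq_Rintegral (f g : T -> R) :
  measurable_fun setT f -> measurable_fun setT g ->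
  {ae P, forall w, f w = g w} -> \int[P]_w f w = \int[P]_w g w.
Proof.
move=> mf mg fg; congr fine; apply: ae_eq_integral => //.
- exact/measurable_EFinP.
- exact/measurable_EFinP.
- by apply: filterS fg => w -> _.
Qed.

Lemma Rintegral_prob_cst (r : R) : \int[P]_w r = r.
Proof. by have := @expectation_cst _ _ _ P r; rewrite unlock /Rintegral => ->. Qed.

End probability.
End tools.

Lemma measurable_cos {R : realType} : measurable_fun setT (@cos R).
Proof. exact: continuous_measurable_fun (@continuous_cos R). Qed.

Lemma measurable_sin {R : realType} : measurable_fun setT (@sin R).
Proof. exact: continuous_measurable_fun (@continuous_sin R). Qed.

(** * Trigonometric approximation of half-lines *)
Section step.
Variable R : realType.
Implicit Types (s x r : R) (n k : nat).

Lemma bernoulli_ineq k x : 0 <= x <= 1 -> 1 - x *+ k <= (1 - x) ^+ k.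
Proof.
move=> /andP[x0 x1]; elim: k => [|k IH]; first by rewrite mulr0n subr0 expr0.
rewrite exprS mulrSr; apply: (@le_trans _ _ ((1 - x) * (1 - x *+ k))).
  by have := mulrn_wge0 k x0; nra.
by rewrite ler_wpM2l// subr_ge0.
Qed.

Lemma mulrn_le_exprD1 k x : 0 <= x -> x *+ k <= (1 + x) ^+ k.
Proof.
move=> x0; elim: k => [|k IH]; first by rewrite mulr0n expr0.
have : 1 <= (1 + x) ^+ k by rewrite exprn_ege1// lerDl.
by rewrite exprS mulrSr; nra.
Qed.

Lemma cvg_mulrn_expr r : 0 <= r < 1 -> (r ^+ n *+ n) @[n --> \oo] --> (0 : R).
Proof.
move=> /andP[]; rewrite le_eqVlt => /predU1P[<- _|r0 r1].
  apply: cvg_near_cst => /=; near=> n.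
  by rewrite expr0n gtn_eqF ?mul0rn//; near: n; exact: nbhs_infty_gt.
pose q := Num.sqrt r.
have q0 : 0 < q by rewrite sqrtr_gt0.
have q1 : q < 1 by rewrite -sqrtr1 ltr_sqrt.
have rE : r = q * q by rewrite -expr2 sqr_sqrtr// ltW.
pose h := q^-1 - 1.
have h0 : 0 < h by rewrite subr_gt0 invf_gt1.
have B n : q ^+ n *+ n <= h^-1.
  have qn0 : 0 < q ^+ n by exact: exprn_gt0.
  have hn : h *+ n <= q^-1 ^+ n.
    by have -> : q^-1 = 1 + h; [rewrite /h addrC subrK|exact/mulrn_le_exprD1/ltW].
  rewrite -mulr_natr -ler_pdivlMl// -exprVn mulrC ler_pdivlMl//.
  by rewrite mulr_natr.
apply: (@squeeze_cvgr _ _ _ _ (cst 0) (fun n => geometric h^-1 q n)).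
- near=> n; apply/andP; split; first by rewrite mulrn_wge0// exprn_ge0// ltW.
  rewrite -[leRHS]/(h^-1 * q ^+ n) rE exprMn -mulrnAl ler_wpM2r//.
  by rewrite exprn_ge0// ltW.
- exact: cvg_cst.
- by apply: cvg_geometric; rewrite ger0_norm// ltW.
Unshelve. all: end_near. Qed.

(** Polynomials which converge boundedly on [-1, 1] to the indicator of
    ]0, 1]. *)
Definition step_poly n s : R := (1 - ((1 - s) / 2) ^+ n) ^+ (n * 2 ^ n).

Lemma step_poly_itv n s : `|s| <= 1 -> 0 <= step_poly n s <= 1.
Proof.
rewrite ler_norml => /andP[s1 s2].
have u0 : 0 <= (1 - s) / 2 by lra.
have u1 : (1 - s) / 2 <= 1 by lra.
have v0 : 0 <= ((1 - s) / 2) ^+ n by exact: exprn_ge0.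
have v1 : ((1 - s) / 2) ^+ n <= 1 by exact: exprn_ile1.
by rewrite /step_poly exprn_ge0 ?subr_ge0//= exprn_ile1// ?subr_ge0// gerBl.
Qed.

(** With u = (1 - s) / 2, the base 1 - u^n is compared with exp(- u^n) when
    u >= 1/2, where n (2u)^n -> +oo, and with Bernoulli's inequality when
    u < 1/2, where n (2u)^n -> 0.  The factor n in the exponent of [step_poly]
    forces the value 0 at s = 0, where the exponent 2^n alone would give
    1/e. *)
Lemma cvg_step_poly s : `|s| <= 1 ->
  step_poly n s @[n --> \oo] --> ((0 < s)%R%:R : R).
Proof.
move=> s1; have := s1; rewrite ler_norml => /andP[s2 s3].
set u := (1 - s) / 2.
have u0 : 0 <= u by rewrite /u; lra.
have u1 : u <= 1 by rewrite /u; lra.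
have v01 n : 0 <= u ^+ n <= 1 by rewrite exprn_ge0//= exprn_ile1.
have [s0|s0] := ltP 0 s.
  apply: (@squeeze_cvgr _ _ _ _ (fun n => 1 - (u * 2) ^+ n *+ n) (cst 1)).
  - near=> n; have /andP[_ ->] := step_poly_itv n s1; rewrite andbT.
    apply: le_trans (bernoulli_ineq _ (v01 n)).
    by rewrite exprMn mulnC mulrnA -natrX mulr_natr.
  - rewrite -[X in _ --> X]subr0; apply: cvgB; first exact: cvg_cst.
    by apply: cvg_mulrn_expr; rewrite mulr_ge0//= /u; lra.
  - exact: cvg_cst.
apply: (@squeeze_cvgr _ _ _ _ (cst 0) (fun n => expR (-1) ^+ n)).
- near=> n; have /andP[-> _] := step_poly_itv n s1.
  rewrite /= /step_poly -/u mulnC exprM.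
  rewrite lerXn2r ?nnegrE ?expR_ge0//.
    by rewrite exprn_ge0// subr_ge0; case/andP: (v01 n).
  apply: (@le_trans _ _ (expR (- u ^+ n) ^+ (2 ^ n))).
    rewrite lerXn2r ?nnegrE ?expR_ge0 ?subr_ge0//; first by case/andP: (v01 n).
    exact: expR_ge1Dx.
  rewrite -expRM_natl ler_expR mulrN lerN2 natrX -exprMn exprn_ege1//.
  by rewrite /u; lra.
- exact: cvg_cst.
- by apply: cvg_expr; rewrite ger0_norm ?expR_ge0// expR_lt1 ltrN10.
Unshelve. all: end_near. Qed.

(** Slowing the oscillation down, x / n ends up in ]-pi, pi[, where the sign of
    the sine is the sign of its argument. *)
Lemma cvg_sin_gt0 x :
  ((0 < sin (x / n.+1%:R))%R%:R : R) @[n --> \oo] --> ((0 < x)%R%:R : R).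
Proof.
apply: cvg_near_cst; near=> n.
have n0 : 0 < n.+1%:R :> R by rewrite ltr0n.
have xn : `|x / n.+1%:R| < pi.
  rewrite normrM normfV (@ger0_norm _ n.+1%:R)// ltr_pdivrMr//.
  rewrite mulrC -ltr_pdivrMr ?pi_gt0//.
  rewrite (@lt_trans _ _ n%:R) ?ltr_nat//.
  by near: n; exact: nbhs_infty_gtr.
move: xn; rewrite ltr_norml => /andP[xn1 xn2].
congr ((_ : bool)%:R : R).
have [x0|x0] := ltP 0 x.
  by rewrite sin_gt0_pi// xn2 divr_gt0.
apply/negbTE; rewrite -leNgt -oppr_ge0 -sinN sin_ge0_pi//.
rewrite oppr_ge0 pmulr_lle0 ?invr_gt0// x0/=.
by rewrite lerNl ltW.
Unshelve. all: end_near. Qed.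

End step.

(** * Trigonometric moments determine the law *)
Definition sigma_of {U I : Type} {R : realType} (c : I -> U -> R) :
    set (set U) :=
  <<s \bigcup_(i in [set: I]) preimage_set_system setT (c i) measurable >>.

Section sigma_of.
Context {U I : Type} {R : realType}.
Implicit Type c : I -> U -> R.

(** The half-lines ]r, +oo[ generate the Borel sets of R. *)
Lemma sigma_of_sub c (S : set (set U)) : sigma_algebra setT S ->
  (forall i (r : R), S [set u | r < c i u]) -> sigma_of c `<=` S.
Proof.
move=> sS Sr; apply: smallest_sub => // A [i _ [B mB <-]]; rewrite setTI.
suff : <<s RGenOInfty.G (R := R) >> `<=` [set B | S (c i @^-1` B)].
  have E : @measurable _ R = <<s RGenOInfty.G (R := R) >>.
    exact: RGenOInfty.measurableE.
  by move=> /(_ B); apply; rewrite -E.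
apply: smallest_sub => [|_ [r ->]]; last first.
  rewrite /= (_ : _ @^-1` _ = [set u | r < c i u]); first exact: Sr.
  by apply/seteqP; split=> u /=; rewrite in_itv/= andbT.
case: sS => S0 SC SU; split => /=.
- by rewrite preimage_set0.
- by move=> C SCC; rewrite setTD -preimage_setC -setTD; exact: SC.
- by move=> F SF; rewrite preimage_bigcup; exact: SU.
Qed.

Lemma sigma_algebra_sigma_of c : sigma_algebra setT (sigma_of c).
Proof. exact: smallest_sigma_algebra. Qed.

Lemma sigma_of_preimage c i (B : set R) :
  measurable B -> sigma_of c (c i @^-1` B).
Proof.
move=> mB; apply: sub_sigma_algebra; exists i => //; exists B => //.
by rewrite setTI.
Qed.

End sigma_of.

Section agreement.
Context {d1 d2 : measure_display} {T1 : measurableType d1}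
  {T2 : measurableType d2} {R : realType}.
Variables (P1 : probability T1 R) (P2 : probability T2 R).
Context {U : Type}.
Variables (V1 : T1 -> U) (V2 : T2 -> U).

Definition same_prob (A : set U) := [/\ measurable (V1 @^-1` A),
  measurable (V2 @^-1` A) & P1 (V1 @^-1` A) = P2 (V2 @^-1` A)].

(** Agreement is preserved by complements and disjoint unions, so that Dynkin's
    pi-lambda theorem applies. *)
Lemma same_prob_sigma (G : set (set U)) : setI_closed G ->
  G `<=` same_prob -> <<s G >> `<=` same_prob.
Proof.
move=> GI GP; rewrite -setI_closed_g_dynkin_g_sigma_algebra//.
apply: smallest_sub => //; split.
- by split; rewrite ?preimage_setT// !probability_setT.
- move=> A [m1 m2 PA]; split; rewrite -?preimage_setC; [exact: measurableC..|].
  by rewrite !probability_setC// PA.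
- move=> F tF sF.
  have t1 : trivIset setT (fun n => V1 @^-1` F n).
    by move=> i j _ _ [u [Fi Fj]]; apply: (tF i j I I); exists (V1 u).
  have t2 : trivIset setT (fun n => V2 @^-1` F n).
    by move=> i j _ _ [u [Fi Fj]]; apply: (tF i j I I); exists (V2 u).
  have m1 n : measurable (V1 @^-1` F n) by case: (sF n).
  have m2 n : measurable (V2 @^-1` F n) by case: (sF n).
  split; rewrite ?preimage_bigcup; [exact: bigcupT_measurable..|].
  rewrite !measure_bigcup//; apply: eq_eseriesr => n _.
  by case: (sF n).
Qed.

Section law.
Context {I : finType}.
Variable c : I -> U -> R.
Hypothesis mc1 : forall i, measurable_fun setT (c i \o V1).
Hypothesis mc2 : forall i, measurable_fun setT (c i \o V2).

Definition wave (a : I -> R) (th : R) (u : U) : R :=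
  cos (\sum_i a i * c i u + th).

(** Boundedness makes this class closed under bounded pointwise limits, by
    dominated convergence. *)
Definition same_mean (h : U -> R) := [/\ measurable_fun setT (h \o V1),
  measurable_fun setT (h \o V2), exists M, forall u, `|h u| <= M &
  \int[P1]_w h (V1 w) = \int[P2]_w h (V2 w)].

Lemma same_meanD h k : same_mean h -> same_mean k ->
  same_mean (fun u => h u + k u).
Proof.
move=> [h1 h2 [M hM] hE] [k1 k2 [N kN] kE]; split.
- exact: measurable_funD.
- exact: measurable_funD.
- by exists (M + N) => u; rewrite (le_trans (ler_normD _ _))// lerD.
- rewrite !RintegralD ?hE ?kE//.
  + exact: (bounded_integrable _ (M := M)).
  + exact: (bounded_integrable _ (M := N)).
  + exact: (bounded_integrable _ (M := M)).
  + exact: (bounded_integrable _ (M := N)).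
Qed.

Lemma same_meanZ r h : same_mean h -> same_mean (fun u => r * h u).
Proof.
move=> [h1 h2 [M hM] hE]; split.
- exact: measurable_funM.
- exact: measurable_funM.
- by exists (`|r| * M) => u; rewrite normrM ler_wpM2l.
- rewrite !RintegralZl ?hE//.
  + exact: (bounded_integrable _ (M := M)).
  + exact: (bounded_integrable _ (M := M)).
Qed.

Lemma same_mean_cvg h_ h M : (forall n, same_mean (h_ n)) ->
  (forall n u, `|h_ n u| <= M) -> (forall u, h_ ^~ u @ \oo --> h u) ->
  same_mean h.
Proof.
move=> sh hM hh.
have mh1 : measurable_fun setT (h \o V1).
  apply: (@measurable_fun_cvg _ _ _ _ (fun n => h_ n \o V1)).
    by move=> n; case: (sh n).
  by move=> x _; exact: hh.
have mh2 : measurable_fun setT (h \o V2).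
  apply: (@measurable_fun_cvg _ _ _ _ (fun n => h_ n \o V2)).
    by move=> n; case: (sh n).
  by move=> x _; exact: hh.
split => //.
  exists M => u; rewrite -(cvg_lim (@Rhausdorff R) (cvg_norm (hh u))).
  apply: limr_le; first by apply/cvg_ex; exists `|h u|; exact: cvg_norm.
  exact: nearW.
have c1 := @bounded_cvg_Rintegral _ _ _ P1 (fun n => h_ n \o V1) _ M
  (fun n => let: And4 a _ _ _ := sh n in a) mh1 (aeW _ (fun w => hh (V1 w)))
  (fun n w => hM n (V1 w)).
have c2 := @bounded_cvg_Rintegral _ _ _ P2 (fun n => h_ n \o V2) _ M
  (fun n => let: And4 _ a _ _ := sh n in a) mh2 (aeW _ (fun w => hh (V2 w)))
  (fun n w => hM n (V2 w)).
have E : (fun n => \int[P1]_w (h_ n \o V1) w) =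
    (fun n => \int[P2]_w (h_ n \o V2) w).
  by apply/funext => n; case: (sh n).
rewrite E in c1; exact: (cvg_unique (@Rhausdorff R) c1 c2).
Qed.

(** Unlike [same_mean], this class is closed under multiplication by the
    functions studied below, because a product of two cosines is a combination
    of cosines of the sum and of the difference of their arguments. *)
Definition wave_stable (h : U -> R) :=
  forall a th, same_mean (fun u => h u * wave a th u).

Definition multiplier (q : U -> R) :=
  forall h, wave_stable h -> wave_stable (fun u => h u * q u).

Lemma wave_bound a th u : `|wave a th u| <= 1. Proof. exact: cos_max. Qed.

(** The constant 1 is a wave, so stability under all waves includes a bound for
    h itself. *)
Lemma wave0 u : wave (cst 0) 0 u = 1.
Proof.
by rewrite /wave big1 ?addr0 ?cos0// => i _; rewrite mul0r.
Qed.

Lemma multiplier_cst r : multiplier (cst r).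
Proof.
move=> h hh a th; have := same_meanZ r (hh a th); congr same_mean.
by apply/funext => u /=; ring.
Qed.

Lemma multiplierD p q : multiplier p -> multiplier q ->
  multiplier (fun u => p u + q u).
Proof.
move=> mp mq h hh a th; have := same_meanD (mp _ hh a th) (mq _ hh a th).
by congr same_mean; apply/funext => u; ring.
Qed.

Lemma multiplierM p q : multiplier p -> multiplier q ->
  multiplier (fun u => p u * q u).
Proof.
move=> mp mq h hh a th; have := mq _ (mp _ hh) a th.
by congr same_mean; apply/funext => u; ring.
Qed.

Lemma multiplierX p n : multiplier p -> multiplier (fun u => p u ^+ n).
Proof.
move=> mp; elim: n => [|n IH].
  exact: (multiplier_cst 1).
have -> : (fun u => p u ^+ n.+1) = (fun u => p u * p u ^+ n).
  by apply/funext => u; rewrite exprS.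
exact: multiplierM.
Qed.

Lemma multiplier_cvg q_ q M : (forall n, multiplier (q_ n)) ->
  (forall n u, `|q_ n u| <= M) -> (forall u, q_ ^~ u @ \oo --> q u) ->
  multiplier q.
Proof.
move=> mq qM qq h hh a th.
have [_ _ [N hN] _] := hh (cst 0) 0.
have {}hN u : `|h u| <= N by have := hN u; rewrite wave0 mulr1.
apply: (@same_mean_cvg (fun n u => h u * q_ n u * wave a th u) _ (N * M)).
- by move=> n; exact: mq.
- move=> n u; rewrite normrM -[leRHS]mulr1 ler_pM// ?wave_bound//.
  by rewrite normrM ler_pM.
- move=> u; apply: cvgM; last exact: cvg_cst.
  by apply: cvgM; [exact: cvg_cst|exact: qq].
Qed.

Lemma multiplier_sin i b r : multiplier (fun u => sin (b * c i u + r)).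
Proof.
move=> h hh a th.
pose a1 := fun j => a j + b * (j == i)%:R.
pose a2 := fun j => a j - b * (j == i)%:R.
have E1 u : \sum_j a1 j * c j u = \sum_j a j * c j u + b * c i u.
  rewrite (eq_bigr (fun j => a j * c j u + b * (j == i)%:R * c j u)).
    rewrite big_split/=; congr (_ + _); rewrite (bigD1 i)//= eqxx mulr1 big1 ?addr0//.
    by move=> j /negbTE ->; rewrite mulr0 mul0r.
  by move=> j _; rewrite mulrDl.
have E2 u : \sum_j a2 j * c j u = \sum_j a j * c j u - b * c i u.
  rewrite (eq_bigr (fun j => a j * c j u - b * (j == i)%:R * c j u)).
    rewrite sumrB; congr (_ - _); rewrite (bigD1 i)//= eqxx mulr1 big1 ?addr0//.
    by move=> j /negbTE ->; rewrite mulr0 mul0r.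
  by move=> j _; rewrite mulrBl.
have := same_meanD (same_meanZ 2^-1 (hh a1 (th + r - pi / 2)))
  (same_meanZ 2^-1 (hh a2 (th - r + pi / 2))).
congr same_mean; apply/funext => u.
rewrite /wave E1 E2; set x := \sum_j _; set y := b * _.
have -> : x + y + (th + r - pi / 2) = (x + th + (y + r)) - pi / 2 by ring.
have -> : x - y + (th - r + pi / 2) = (x + th - (y + r)) + pi / 2 by ring.
rewrite cosBpihalf cosDpihalf sinD sinB; by field.
Qed.

(** The indicator of c i > r is a two-step bounded limit: first polynomials in
    sin((c i - r) / n) converge to the indicator of a positive sine, then n goes
    to infinity. *)
Lemma multiplier_gt i r : multiplier (fun u => (r < c i u)%R%:R).
Proof.
have msin n : multiplier (fun u => (0 < sin ((c i u - r) / n.+1%:R))%R%:R).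
  pose s u := sin ((c i u - r) / n.+1%:R).
  have ms : multiplier s.
    have := multiplier_sin i n.+1%:R^-1 (- (r / n.+1%:R)).
    by congr multiplier; apply/funext => u; rewrite /s mulrBl mulrC.
  apply: (@multiplier_cvg (fun k u => step_poly k (s u)) _ 1).
  - move=> k; rewrite /step_poly; apply: multiplierX.
    have -> : (fun u => 1 - ((1 - s u) / 2) ^+ k) =
        (fun u => cst 1 u + cst (-1) u * (2^-1 + (- 2^-1) * s u) ^+ k).
      apply/funext => u /=; rewrite mulN1r; congr (_ - _ ^+ _); by field.
    apply: multiplierD; first exact: multiplier_cst.
    apply: multiplierM; first exact: multiplier_cst.
    apply: multiplierX; apply: multiplierD; first exact: multiplier_cst.
    by apply: multiplierM => //; exact: multiplier_cst.
  - move=> k u; have /andP[? ?] := step_poly_itv k (sin_max ((c i u - r) / n.+1%:R)).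
    by rewrite ger0_norm.
  - by move=> u; apply: cvg_step_poly; exact: sin_max.
apply: (multiplier_cvg (M := 1) msin).
- by move=> n u; case: (_ < _)%R; rewrite ?normr1 ?normr0.
- by move=> u; have := @cvg_sin_gt0 R (c i u - r); rewrite subr_gt0.
Qed.

Hypothesis same_wave : forall a th,
  \int[P1]_w wave a th (V1 w) = \int[P2]_w wave a th (V2 w).

Lemma wave_stable1 : wave_stable (cst 1).
Proof.
have mwave d (T : measurableType d) (V : T -> U) a th :
    (forall i, measurable_fun setT (c i \o V)) ->
    measurable_fun setT (wave a th \o V).
  move=> mc; apply: (measurableT_comp measurable_cos) => /=.
  apply: measurable_funD => //; apply: measurable_sum => i.
  by apply: measurable_funM => //; exact: mc.
move=> a th; under [X in same_mean X]eq_fun do rewrite mul1r.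
split; [exact: mwave..|by exists 1 => u; exact: wave_bound|exact: same_wave].
Qed.

(** Indicators of the boxes, i.e. of finite intersections of half-spaces
    c i > r, are products of multipliers; the boxes form a pi-system which
    generates [sigma_of c]. *)
Lemma same_law : sigma_of c `<=` same_prob.
Proof.
pose box (s : seq (I * R)) := [set u | all (fun p => p.2 < c p.1 u) s].
pose G := [set A | exists s, A = box s].
have GI : setI_closed G.
  move=> _ _ [s ->] [t ->]; exists (s ++ t); apply/seteqP; split => u; rewrite /box /=.
    by rewrite all_cat => -[-> ->].
  by rewrite all_cat => /andP[-> ->].
have Gbox : G `<=` same_prob.
  move=> _ [s ->].
  have mbox d (T : measurableType d) (V : T -> U) :
      (forall i, measurable_fun setT (c i \o V)) -> measurable (V @^-1` box s).
    move=> mc; elim: s => [|[i r] s IH].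
      by rewrite (_ : _ @^-1` _ = setT)//; apply/seteqP; split.
    rewrite (_ : _ @^-1` _ = (c i \o V) @^-1` `]r, +oo[ `&` (V @^-1` box s)).
      by apply: measurableI => //; rewrite -[X in measurable X]setTI; exact: mc.
    apply/seteqP; split => u; rewrite /box /= in_itv/= andbT.
      by move=> /andP[].
    by move=> [-> ->].
  have m1 := mbox _ _ _ mc1; have m2 := mbox _ _ _ mc2.
  split=> //.
  have mult : multiplier (fun u => (all (fun p => p.2 < c p.1 u) s)%:R).
    elim: s {m1 m2 mbox} => [|[i r] s IH]; first exact: (multiplier_cst 1).
    have := multiplierM (multiplier_gt i r) IH; congr multiplier.
    by apply/funext => u /=; rewrite -natrM mulnb.
  have [_ _ _] := mult _ wave_stable1 (cst 0) 0.
  rewrite /Rintegral.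
  under eq_integral do rewrite wave0 mulr1 mul1r.
  under [in X in _ = X -> _]eq_integral do rewrite wave0 mulr1 mul1r.
  have E d (T : measurableType d) (P : probability T R) (V : T -> U) :
      measurable (V @^-1` box s) ->
      (\int[P]_w ((all (fun p => p.2 < c p.1 (V w)) s)%:R)%:E)%E =
      P (V @^-1` box s).
    move=> mV; rewrite -[in RHS](setIT (V @^-1` _)) -integral_indic//.
    by apply: eq_integral => w _; rewrite indicE mem_setE.
  rewrite !E// => PE.
  by rewrite -[LHS]fineK ?fin_num_measure// PE fineK// fin_num_measure.
apply: subset_trans (same_prob_sigma GI Gbox).
apply: sigma_of_sub; first exact: smallest_sigma_algebra.
move=> i r; apply: sub_sigma_algebra; exists [:: (i, r)].
by apply/seteqP; split => u; rewrite /box /= andbT.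
Qed.

End law.
End agreement.

(** * The characteristic function of the normal law *)

(** The fundamental theorem of calculus on [-n, n], then n to infinity. *)
Lemma Rintegral_derive_eq0 {R : realType} (F h : R -> R) :
  (forall x : R, is_derive x 1 F (h x)) -> continuous h ->
  (@lebesgue_measure R).-integrable setT (EFin \o h) ->
  F n%:R @[n --> \oo] --> (0 : R) -> F (- n%:R) @[n --> \oo] --> (0 : R) ->
  \int[@lebesgue_measure R]_x h x = 0.
Proof.
move=> dF ch ih F1 F2.
pose D (n : nat) := `[- n%:R, n%:R]%classic : set R.
have mh : measurable_fun setT h by exact: continuous_measurable_fun.
have derF (x : R) : derivable F x 1 by have [] := dF x.
have cF : continuous F.
  by move=> x; apply: differentiable_continuous; exact/derivable1_diffP.
have E n : \int[@lebesgue_measure R]_x (h \_ (D n.+1)) x =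
    F n.+1%:R - F (- n.+1%:R).
  rewrite -Rintegral_mkcond /Rintegral (@continuous_FTC2 _ h F)//.
  - by rewrite (@lt_trans _ _ 0)// ?oppr_lt0 ltr0n.
  - exact: continuous_subspaceT.
  - split; first by move=> x _; exact: derF.
    + exact/cvg_at_right_filter/cF.
    + exact/cvg_at_left_filter/cF.
  - by move=> x _; rewrite derive1E; exact: derive_val.
have c1 : \int[@lebesgue_measure R]_x (h \_ (D n.+1)) x @[n --> \oo] --> (0 : R).
  rewrite (funext E) -[X in _ --> X](subr0 (0 : R)); apply: cvgB.
    by rewrite (cvg_shiftS (fun n => F n%:R)).
  by rewrite (cvg_shiftS (fun n => F (- n%:R))).
have c2 := @dominated_cvg_Rintegral _ _ _ (@lebesgue_measure R)
  (fun n => h \_ (D n.+1)) h (fun x => `|h x|).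
have /(cvg_unique (@Rhausdorff R) c1) -> // : \int[@lebesgue_measure R]_x
    (h \_ (D n.+1)) x @[n --> \oo] --> \int[@lebesgue_measure R]_x h x.
apply: c2 => //.
- move=> n; apply/(measurable_restrictT _ _).1 => //.
    exact: measurable_itv.
  exact: measurable_funTS.
- apply: aeW => x; apply: cvg_near_cst; near=> n.
  rewrite patchE mem_set// /D /= in_itv/= -ler_norml.
  rewrite (@le_trans _ _ n%:R) ?ler_nat//.
  by near: n; exact: nbhs_infty_ger.
- by have := integrable_norm ih.
- by move=> n x; rewrite patchE; case: ifP => // _; rewrite normr0.
Unshelve. all: end_near. Qed.

Lemma cvg_mul_bounded0 {R : realType} (c b : nat -> R) :
  (forall n, `|b n| <= 1) -> c n @[n --> \oo] --> (0 : R) ->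
  c n * b n @[n --> \oo] --> (0 : R).
Proof.
move=> b1 c0; apply: norm_cvg0.
apply: (@squeeze_cvgr _ _ _ _ (cst 0) (fun n => `|c n|)).
- by near=> n; rewrite normr_ge0/= normrM -[leRHS]mulr1 ler_wpM2l.
- exact: cvg_cst.
- by rewrite -(@normr0 _ R); exact: cvg_norm.
Unshelve. all: end_near. Qed.

Section normal.
Variable R : realType.
Variables (m s : R).
Hypothesis s0 : s != 0.
Local Notation mu := (@lebesgue_measure R).
Local Notation g := (normal_pdf m s).

(** The density agrees almost everywhere with the Radon-Nikodym derivative. *)
Lemma Rintegral_normal_prob (f : R -> R) (M : R) : measurable_fun setT f ->
  (forall x, `|f x| <= M) ->
  \int[normal_prob m s]_x f x = \int[mu]_x (f x * g x).
Proof.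
move=> mf fM; congr fine.
have dom := @normal_prob_dominates R m s.
rewrite -(Radon_Nikodym_change_of_variables dom)//=; last first.
  exact: (bounded_integrable _ (M := M)).
have mEf : measurable_fun setT (EFin \o f) by exact/measurable_EFinP.
have mg : measurable_fun setT (fun x => (g x)%:E).
  by apply/measurable_EFinP; exact: measurable_normal_pdf.
under [in RHS]eq_integral do rewrite EFinM.
apply: ae_eq_integral => //.
- apply: emeasurable_funM => //; apply: (measurable_int mu).
- by apply: emeasurable_funM.
- apply: ae_eqe_mul2l => /=.
  rewrite Radon_NikodymE//=.
  case: cid => /= h [h1 h2 h3].
  apply: integral_ae_eq => //=.
  by move=> E _ mE; rewrite -h3.
Qed.

Lemma normal_pdf_expR x : g x = normal_peak s * expR (- (x - m) ^+ 2 / (s ^+ 2 *+ 2)).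
Proof. by rewrite normal_pdfE. Qed.

Lemma is_derive_normal_pdf (x : R) : is_derive x 1 g (- (x - m) / s ^+ 2 * g x).
Proof.
have dq : is_derive x 1 (fun x : R => - (x - m) ^+ 2 / (s ^+ 2 *+ 2))
    (- (x - m) / s ^+ 2).
  have -> : (fun x : R => - (x - m) ^+ 2 / (s ^+ 2 *+ 2)) =
      (- (s ^+ 2 *+ 2)^-1) *: (id - cst m : R -> R) ^+ 2.
    by apply/funext => y; rewrite -[RHS]/(- (s ^+ 2 *+ 2)^-1 * (y - m) ^+ 2); ring.
  apply: is_derive_eq; rewrite /GRing.scale/= !fctE.
  by field.
have := is_derive1_comp (@is_derive_expR R _) dq.
move=> /(is_deriveZ (normal_peak s)).
have -> : normal_peak s \*: (expR \o (fun x : R => - (x - m) ^+ 2 / (s ^+ 2 *+ 2))) = g.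
  by apply/funext => y; rewrite normal_pdf_expR.
move=> dg; apply: (is_derive_eq dg); rewrite normal_pdf_expR /GRing.scale/=; ring.
Qed.

Lemma expR_half_sqr_ge (t : R) : t <= expR (t ^+ 2 / 4).
Proof.
apply: le_trans (expR_ge1Dx _).
by have := sqr_ge0 (t / 2 - 1); rewrite !expr2; nra.
Qed.

(** |y| <= |s| exp(y^2 / (4 s^2)) trades the linear factor for a normal density
    of variance 2 s^2. *)
Lemma integrable_center_normal_pdf :
  mu.-integrable setT (EFin \o (fun x => `|x - m| * g x)).
Proof.
pose s' := Num.sqrt 2 * s.
have s'0 : s' != 0 by rewrite mulf_neq0// gt_eqF// sqrtr_gt0.
pose C := `|s| * normal_peak s / normal_peak s'.
apply: (@le_integrable _ _ _ mu _ measurableT _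
  (fun x => C%:E * (normal_pdf m s' x)%:E)%E).
- apply/measurable_EFinP; apply: measurable_funM; last exact: measurable_normal_pdf.
  apply: measurableT_comp => //.
  exact: measurable_funB.
- move=> x _; rewrite /= lee_fin.
  have p0 : 0 < normal_peak s' by exact: normal_peak_gt0.
  have p1 : 0 < normal_peak s by exact: normal_peak_gt0.
  rewrite ger0_norm; last by rewrite mulr_ge0// normal_pdf_ge0.
  apply: le_trans (ler_norm _).
  rewrite normal_pdf_expR normal_pdfE// /C.
  have -> : `|s| * normal_peak s / normal_peak s' *
     (normal_peak s' * normal_fun m s' x) = `|s| * normal_peak s * normal_fun m s' x.
    by field; exact: lt0r_neq0.
  rewrite mulrCA [X in _ <= X * _]mulrC -[leRHS]mulrA ler_wpM2l ?(ltW p1)// /normal_fun.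
  have s'E : s' ^+ 2 = s ^+ 2 *+ 2.
    by rewrite exprMn sqr_sqrtr// mulrC mulr_natr.
  rewrite s'E.
  have sn : 0 < `|s| by rewrite normr_gt0.
  have := expR_half_sqr_ge (`|x - m| / `|s|).
  rewrite ler_pdivrMr// mulrC => /(ler_wpM2r (expR_ge0 (- (x - m) ^+ 2 / (s ^+ 2 *+ 2)))).
  move=> /le_trans; apply; rewrite -mulrA -expRD ler_wpM2l// ler_expR.
  rewrite exprMn exprVn !real_normK ?num_real//.
  by rewrite le_eqVlt; apply/orP; left; apply/eqP; field.
- by apply: integrableZl => //; exact: integrable_normal_pdf.
Qed.

Lemma cvg_normal_pdf_infty (y : nat -> R) : (forall n, `|y n| = n%:R) ->
  g (y n) @[n --> \oo] --> (0 : R).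
Proof.
move=> yn.
have sn : 0 < `|s| by rewrite normr_gt0.
have p1 : 0 < normal_peak s by exact: normal_peak_gt0.
apply: (@squeeze_cvgr _ _ _ _ (cst 0)
  (fun n => normal_peak s * `|s| * (n%:R - `|m|)^-1)).
- near=> n; rewrite normal_pdf_ge0/= normal_pdf_expR -mulrA ler_wpM2l ?(ltW p1)//.
  have nm : 0 < n%:R - `|m|.
    by rewrite subr_gt0; near: n; exact: nbhs_infty_gtr.
  set x := y n.
  have xm : n%:R - `|m| <= `|x - m|.
    by apply: le_trans (lerB_dist _ _); rewrite yn.
  rewrite mulNr expRN ler_pdivlMr// mulrC ler_pdivrMr ?expR_gt0//.
  apply: (le_trans xm).
  have := expR_half_sqr_ge (`|x - m| / `|s|).
  rewrite ler_pdivrMr// mulrC => /le_trans; apply.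
  rewrite ler_wpM2l// ler_expR exprMn exprVn !real_normK ?num_real//.
  have -> : (x - m) ^+ 2 / (s ^+ 2 *+ 2) = (x - m) ^+ 2 / s ^+ 2 / 2 by field.
  have : 0 <= (x - m) ^+ 2 / s ^+ 2 by rewrite mulr_ge0 ?sqr_ge0// invr_ge0 sqr_ge0.
  by lra.
- exact: cvg_cst.
- rewrite -[X in _ --> X](mulr0 (normal_peak s * `|s|)).
  apply: cvgM; first exact: cvg_cst.
  apply: (gtr0_cvgV0 _).2.
    by near=> n; rewrite subr_gt0; near: n; exact: nbhs_infty_gtr.
  exact: cvg_comp cvgr_idn (cvg_addrr (- `|m|)).
Unshelve. all: end_near. Qed.

Lemma integrable_bounded_normal_pdf (b : R -> R) : measurable_fun setT b ->
  (forall x, `|b x| <= 1) -> mu.-integrable setT (EFin \o (fun x => b x * g x)).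
Proof.
move=> mb b1.
apply: (@le_integrable _ _ _ mu _ measurableT _ (EFin \o g)).
- apply/measurable_EFinP; apply: measurable_funM => //.
  exact: measurable_normal_pdf.
- move=> x _; rewrite /= lee_fin normrM -[leRHS]mul1r ler_wpM2r//.
- exact: integrable_normal_pdf.
Qed.

Lemma integrable_center_bounded_normal_pdf (b : R -> R) : measurable_fun setT b ->
  (forall x, `|b x| <= 1) ->
  mu.-integrable setT (EFin \o (fun x => (x - m) * b x * g x)).
Proof.
move=> mb b1.
apply: (le_integrable measurableT _ _ integrable_center_normal_pdf).
- apply/measurable_EFinP; apply: measurable_funM.
    by apply: measurable_funM => //; exact: measurable_funB.
  exact: measurable_normal_pdf.
- move=> x _; rewrite /= lee_fin !normrM normr_id ler_wpM2r//.
  by rewrite -[leRHS]mulr1 ler_wpM2l.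
Qed.

Let phase (u th x : R) := u * (x - m) + th.

Lemma continuous_phase u th : continuous (phase u th).
Proof.
move=> x; apply: cvgD; last exact: cvg_cst.
apply: cvgM; first exact: cvg_cst.
by apply: cvgB; [exact: cvg_id|exact: cvg_cst].
Qed.

Lemma continuous_cos_phase u th : continuous (cos \o phase u th).
Proof.
by move=> x; apply: continuous_comp; [exact: continuous_phase|exact: continuous_cos].
Qed.

Lemma continuous_sin_phase u th : continuous (sin \o phase u th).
Proof.
by move=> x; apply: continuous_comp; [exact: continuous_phase|exact: continuous_sin].
Qed.

Lemma measurable_cos_phase u th : measurable_fun setT (cos \o phase u th).
Proof. by apply: continuous_measurable_fun; exact: continuous_cos_phase. Qed.

Lemma measurable_sin_phase u th : measurable_fun setT (sin \o phase u th).
Proof. by apply: continuous_measurable_fun; exact: continuous_sin_phase. Qed.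

Lemma is_derive_phase u th (x : R) : is_derive x 1 (phase u th) u.
Proof.
have -> : phase u th = u *: (id - cst m : R -> R) + cst th by [].
by apply: is_derive_eq; rewrite /GRing.scale/= subr0 mulr1 addr0.
Qed.

(** Stein's identity for a sine: the derivative of sin * g integrates to 0, and
    g' = - (x - m) / s^2 * g. *)
Lemma Rintegral_center_sin_normal_pdf u th :
  \int[mu]_x ((x - m) * sin (u * (x - m) + th) * g x) =
  s ^+ 2 * u * \int[mu]_x (cos (u * (x - m) + th) * g x).
Proof.
pose h x := - (s ^+ 2)^-1 * ((x - m) * sin (phase u th x) * g x) +
            u * (cos (phase u th x) * g x).
have i1 := integrable_center_bounded_normal_pdf (measurable_sin_phase u th)
  (fun x => sin_max (phase u th x)).
have i2 := integrable_bounded_normal_pdf (measurable_cos_phase u th)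
  (fun x => cos_max (phase u th x)).
have i1' : mu.-integrable setT
    (EFin \o (fun x => - (s ^+ 2)^-1 * ((x - m) * sin (phase u th x) * g x))).
  have := integrableZl measurableT (- (s ^+ 2)^-1) i1.
  by apply: eq_integrable => // x _ /=; rewrite EFinM.
have i2' : mu.-integrable setT (EFin \o (fun x => u * (cos (phase u th x) * g x))).
  have := integrableZl measurableT u i2.
  by apply: eq_integrable => // x _ /=; rewrite EFinM.
have : \int[mu]_x h x = 0.
  apply: (@Rintegral_derive_eq0 _ (g * (sin \o phase u th))).
  - move=> x; have dg := is_derive_normal_pdf x.
    have ds := is_derive1_comp (@is_derive_sin R (phase u th x)) (is_derive_phase u th x).
    apply: is_derive_eq; rewrite /GRing.scale/= /h; ring.
  - have cg : continuous g by exact: continuous_normal_pdf.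
    move=> x; apply: cvgD.
      apply: cvgM; first exact: cvg_cst.
      apply: cvgM; last exact: cg.
      apply: cvgM; last exact: continuous_sin_phase.
      by apply: cvgB; [exact: cvg_id|exact: cvg_cst].
    apply: cvgM; first exact: cvg_cst.
    by apply: cvgM; [exact: continuous_cos_phase|exact: cg].
  - have := integrableD measurableT i1' i2'.
    by apply: eq_integrable => // x _ /=; rewrite EFinD.
  - apply: cvg_mul_bounded0; first by move=> n; exact: sin_max.
    by apply: cvg_normal_pdf_infty => n; rewrite ger0_norm.
  - apply: cvg_mul_bounded0; first by move=> n; exact: sin_max.
    by apply: cvg_normal_pdf_infty => n; rewrite normrN ger0_norm.
rewrite RintegralD// RintegralZl// RintegralZl//.
move=> E; apply/(@mulfI _ (s ^+ 2)^-1).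
  by rewrite invr_eq0 expf_neq0.
have s2 : s ^+ 2 != 0 by rewrite expf_neq0.
rewrite mulrA mulrA mulVf// mul1r.
by apply/eqP; rewrite -subr_eq0 -oppr_eq0 opprB addrC -mulNr E.
Qed.

Lemma is_derive_Rintegral_cos_normal_pdf th (u : R) :
  is_derive u 1 (fun u => \int[mu]_x (cos (phase u th x) * g x))
    (- (s ^+ 2 * u) * \int[mu]_x (cos (phase u th x) * g x)).
Proof.
pose f u x := cos (phase u th x) * g x.
have Iu : `]u - 1, u + 1[%classic u by rewrite /= in_itv/=; lra.
have dw x (v : R) : is_derive v 1 (fun v => phase v th x) (x - m).
  have -> : (fun v => phase v th x) = (x - m) *: (id : R -> R) + cst th.
    by apply/funext => y; rewrite /phase mulrC.
  by apply: is_derive_eq; rewrite /GRing.scale/= mulr1 addr0.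
have df x (v : R) : is_derive v 1 (f ^~ x) (- ((x - m) * sin (phase v th x) * g x)).
  have dc := @is_derive1_comp R (@cos R) (fun v => phase v th x) _ _ _
    (@is_derive_cos R (phase v th x)) (dw x v).
  have -> : f ^~ x = g x \*: (cos \o (fun v => phase v th x)).
    by apply/funext => y; rewrite /f/= /GRing.scale/= mulrC.
  apply: is_derive_eq; rewrite /GRing.scale/=; ring.
have p1 x v : partial1of2 f v x = - ((x - m) * sin (phase v th x) * g x).
  by rewrite partial1of2E; exact: derive_val.
have H1 : forall v, `]u - 1, u + 1[%classic v -> mu.-integrable setT (EFin \o f v).
  move=> v _.
  exact: (integrable_bounded_normal_pdf (measurable_cos_phase v th) (fun x => cos_max _)).
have H2 : forall v x, `]u - 1, u + 1[%classic v -> setT x ->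
    derivable (f ^~ x) v 1.
  by move=> v x _ _; have [] := df x v.
have G0 : forall x, 0 <= `|x - m| * g x.
  by move=> x; rewrite mulr_ge0// normal_pdf_ge0.
have H3 : forall v x, `]u - 1, u + 1[%classic v -> setT x ->
    `|partial1of2 f v x| <= `|x - m| * g x.
  move=> v x _ _; rewrite p1 normrN !normrM (ger0_norm (normal_pdf_ge0 _ _ _)).
  by rewrite ler_wpM2r ?normal_pdf_ge0// -[leRHS]mulr1 ler_wpM2l// sin_max.
have dI := derivable_under_integral measurableT Iu H1 H2 G0
  integrable_center_normal_pdf H3.
apply: DeriveDef => //.
rewrite -derive1E.
have -> := differentiation_under_integral measurableT Iu H1 H2 G0
  integrable_center_normal_pdf H3.
under eq_Rintegral do rewrite p1 -mulN1r.
rewrite RintegralZl//; last first.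
  exact: (integrable_center_bounded_normal_pdf (measurable_sin_phase u th) (fun x => sin_max _)).
by rewrite Rintegral_center_sin_normal_pdf mulN1r mulNr.
Qed.

(** As a function of u the integral solves phi' = - s^2 u phi, so its product
    with exp(s^2 u^2 / 2) is constant, equal to its value at u = 0. *)
Lemma Rintegral_cos_normal_pdf u th :
  \int[mu]_x (cos (u * (x - m) + th) * g x) =
  cos th * expR (- (s ^+ 2 * u ^+ 2 / 2)).
Proof.
pose phi v := \int[mu]_x (cos (phase v th x) * g x).
pose K v := phi v * expR (s ^+ 2 * v ^+ 2 / 2).
have dK (v : R) : is_derive v 1 K 0.
  have dp : is_derive v 1 phi _ := is_derive_Rintegral_cos_normal_pdf th v.
  have dq : is_derive v 1 (fun v : R => s ^+ 2 * v ^+ 2 / 2) (s ^+ 2 * v).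
    have -> : (fun v : R => s ^+ 2 * v ^+ 2 / 2) =
        (s ^+ 2 / 2) \*: (id : R -> R) ^+ 2.
      apply/funext => y; rewrite -[RHS]/(s ^+ 2 / 2 * y ^+ 2); ring.
    by apply: is_derive_eq; rewrite /GRing.scale/=; field.
  have de := is_derive1_comp (@is_derive_expR R _) dq.
  have -> : K = phi * (expR \o (fun v : R => s ^+ 2 * v ^+ 2 / 2)) by [].
  apply: is_derive_eq; rewrite /GRing.scale/= -/(phi v); ring.
have := is_derive_0_is_cst u 0 dK.
have -> : K 0 = cos th.
  rewrite /K /phi expr0n/= mulr0 mul0r expR0 mulr1 /phase.
  under eq_Rintegral do rewrite mul0r add0r.
  rewrite RintegralZl//; last exact: integrable_normal_pdf.
  by rewrite /Rintegral integral_normal_pdf mulr1.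
move=> <-; by rewrite /K -[RHS]mulrA -expRD subrr expR0 mulr1.
Qed.

End normal.

(** * Moments read off from the characteristic function *)
Section limits.
Context {R : realType}.
Implicit Types x y : R.

Lemma normr_sin_le x : `|sin x| <= `|x|.
Proof.
wlog x0 : x / 0 <= x.
  move=> H; have [/H//|x0] := leP 0 x.
  by rewrite -normrN -sinN -(normrN x); apply: H; rewrite oppr_ge0 ltW.
have [|c _] := @MVT_segment R (@sin R) (@cos R) 0 x x0.
- by apply: continuous_subspaceT => y; exact: continuous_sin.
- rewrite sin0 !subr0 => ->; rewrite normrM -[leRHS]mul1r.
  by rewrite ler_wpM2r// cos_max.
Qed.

Lemma cvg_difference_quotient (f : R -> R) (l : R) (u : nat -> R) :
  is_derive (0 : R) 1 f l -> (forall n, u n != 0) ->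
  u n @[n --> \oo] --> (0 : R) ->
  (u n)^-1 * (f (u n) - f 0) @[n --> \oo] --> l.
Proof.
move=> [df dl] u0 cu.
have : h^-1 *: (f (h *: 1 + 0) - f 0) @[h --> (0 : R)^'] --> l.
  by rewrite -dl /derive; exact: df.
under eq_fun do rewrite addr0 /GRing.scale/= mulr1.
by move/cvgr_dnbhsP; apply.
Qed.

Lemma cvg_natS_inv (y : R) : y / n.+1%:R @[n --> \oo] --> (0 : R).
Proof.
rewrite -(mulr0 y); apply: cvgM; first exact: cvg_cst.
by apply: cvg_trans (@cvg_harmonic R).
Qed.

Lemma cvg_natS_inv_sqr : n.+1%:R ^- 2 @[n --> \oo] --> (0 : R).
Proof.
have E (n : nat) : n.+1%:R ^- 2 = 1 / n.+1%:R * (1 / n.+1%:R) :> R.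
  by rewrite !div1r -exprVn expr2.
rewrite (funext E) -[X in _ --> X](mulr0 (0 : R)).
by apply: cvgM; exact: cvg_natS_inv.
Qed.

Lemma cvg_natS_sin y : n.+1%:R * sin (y / n.+1%:R) @[n --> \oo] --> y.
Proof.
have [->|y0] := eqVneq y 0.
  by under eq_fun do rewrite mul0r sin0 mulr0; exact: cvg_cst.
have H n : y / n.+1%:R != 0 by rewrite mulf_neq0// invr_eq0.
have := cvg_difference_quotient (@is_derive_sin R 0) H (cvg_natS_inv y).
move=> /(cvgM (cvg_cst y)); rewrite cos0 mulr1.
apply: cvg_trans; apply: near_eq_cvg; apply: nearW => n /=.
by rewrite sin0 subr0; field; rewrite y0 nat1r pnatr_eq0.
Qed.

Lemma cvg_mul_1expR (v : R) (a : nat -> R) : (forall n, a n != 0) ->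
  (a n)^-1 @[n --> \oo] --> (0 : R) ->
  a n * (1 - expR (- (v / a n))) @[n --> \oo] --> v.
Proof.
move=> a0 ca; have [->|v0] := eqVneq v 0.
  by under eq_fun do rewrite mul0r oppr0 expR0 subrr mulr0; exact: cvg_cst.
have H n : - (v / a n) != 0 by rewrite oppr_eq0 mulf_neq0// invr_eq0.
have cH : - (v / a n) @[n --> \oo] --> (0 : R).
  rewrite -oppr0; apply: cvgN; rewrite -(mulr0 v).
  by apply: cvgM => //; exact: cvg_cst.
have := cvg_difference_quotient (@is_derive_expR R 0) H cH.
rewrite expR0 => /(cvgM (cvg_cst v)); rewrite mulr1.
apply: cvg_trans; apply: near_eq_cvg; apply: nearW => n /=.
by field; rewrite v0 a0.
Qed.

End limits.

Lemma Rintegral_eq_law {d1 d2 : measure_display} {T1 : measurableType d1}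
    {T2 : measurableType d2} {R : realType} (P1 : probability T1 R)
    (P2 : probability T2 R) (Y1 : T1 -> R) (Y2 : T2 -> R) (f : R -> R) (M : R) :
  measurable_fun setT Y1 -> measurable_fun setT Y2 -> measurable_fun setT f ->
  (forall y, `|f y| <= M) ->
  (forall B, measurable B -> P1 (Y1 @^-1` B) = P2 (Y2 @^-1` B)) ->
  \int[P1]_w f (Y1 w) = \int[P2]_w f (Y2 w).
Proof.
move=> m1 m2 mf fM E.
have mEf : measurable_fun setT (EFin \o f) by exact/measurable_EFinP.
have push d (T : measurableType d) (P : probability T R) (Y : {mfun T >-> R}) :
    (\int[P]_w (f (Y w))%:E = \int[pushforward P Y]_y (f y)%:E)%E.
  rewrite integral_pushforward//.
  by apply: (bounded_integrable _ (M := M)) => //; exact: measurableT_comp.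
pose X1 : {mfun T1 >-> R} := HB.pack Y1 (isMeasurableFun.Build _ _ _ _ Y1 m1).
pose X2 : {mfun T2 >-> R} := HB.pack Y2 (isMeasurableFun.Build _ _ _ _ Y2 m2).
rewrite /Rintegral (push _ _ P1 X1) (push _ _ P2 X2); congr fine.
by apply: eq_measure_integral => A mA _; exact: E.
Qed.

Section law.
Context {d : measure_display} {T : measurableType d} {R : realType}.
Variable P : probability T R.
Implicit Types (L : T -> R).

(** The degenerate case s = 0, a point mass, obeys the same formula. *)
Lemma normal_law_wave L (m s : R) : measurable_fun setT L ->
  (forall B, measurable B -> P (L @^-1` B) = normal_law m s B) ->
  forall u th, \int[P]_w cos (u * L w + th) =
    cos (u * m + th) * expR (- (u ^+ 2 * s ^+ 2 / 2)).
Proof.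
move=> mL lL u th.
pose f y := cos (u * y + th).
have mf : measurable_fun setT f.
  apply: (measurableT_comp measurable_cos).
  by apply: measurable_funD => //; exact: measurable_funM.
have mEf : measurable_fun setT (EFin \o f) by exact/measurable_EFinP.
have [s0|s0] := eqVneq s 0.
  rewrite (@Rintegral_eq_law _ _ _ _ _ P (\d_m) L id f 1) //; last 2 first.
  - by move=> w; exact: cos_max.
  - by move=> B mB; rewrite lL// /normal_law s0 eqxx.
  rewrite /Rintegral integral_dirac// diracT mul1e/= s0 expr0n/=.
  by rewrite !(mulr0, mul0r) oppr0 expR0 mulr1.
rewrite (@Rintegral_eq_law _ _ _ _ _ P (normal_prob m s) L id f 1) //; last 2 first.
- by move=> w; exact: cos_max.
- by move=> B mB; rewrite lL// /normal_law (negbTE s0).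
rewrite (@Rintegral_normal_prob _ m s f 1 mf); last by move=> x; exact: cos_max.
rewrite [u ^+ 2 * _]mulrC -(@Rintegral_cos_normal_pdf _ m s s0).
by apply: eq_Rintegral => x _; congr (cos _ * _); ring.
Qed.

Lemma measurable_wave L u th : measurable_fun setT L ->
  measurable_fun setT (fun w => cos (u * L w + th)).
Proof.
move=> mL; apply: (measurableT_comp measurable_cos).
by apply: measurable_funD => //; exact: measurable_funM.
Qed.

Lemma Lfun_measurable (p : \bar R) L : L \in Lfun P p -> measurable_fun setT L.
Proof. by move=> /sub_Lfun_mfun; rewrite inE. Qed.

Lemma Lfun2_integrable L : L \in Lfun P 2%:E -> P.-integrable setT (EFin \o L).
Proof.
move=> L2; apply/Lfun1_integrable; apply: Lfun_subset12 => //.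
exact: fin_num_measure.
Qed.

Lemma Rintegral_cosBpihalf L (u : R) : \int[P]_w cos (u * L w + (- (pi / 2))) =
  \int[P]_w sin (u * L w).
Proof. by apply: eq_Rintegral => w _; rewrite cosBpihalf. Qed.

(** n sin(L / n) -> L, dominated by |L|. *)
Lemma mean_of_wave L (m v : R) : L \in Lfun P 2%:E ->
  (forall u th, \int[P]_w cos (u * L w + th) =
    cos (u * m + th) * expR (- (u ^+ 2 * v / 2))) ->
  \int[P]_w L w = m.
Proof.
move=> L2 wL; have mL := Lfun_measurable L2.
have iL := Lfun2_integrable L2.
have c1 : \int[P]_w (n.+1%:R * sin (L w / n.+1%:R)) @[n --> \oo] --> \int[P]_w L w.
  apply: (@dominated_cvg_Rintegral _ _ _ P _ _ (fun w => `|L w|)) => //.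
  - move=> n; apply: measurable_funM => //; apply: (measurableT_comp measurable_sin).
    exact: measurable_funM.
  - by apply: aeW => w; exact: cvg_natS_sin.
  - by have := integrable_norm iL.
  - move=> n w; rewrite normrM ger0_norm// -ler_pdivlMl ?ltr0n//.
    apply: (le_trans (normr_sin_le _)).
    by rewrite normrM normfV (@ger0_norm _ n.+1%:R)// mulrC.
have E n : \int[P]_w (n.+1%:R * sin (L w / n.+1%:R)) =
    n.+1%:R * sin (m / n.+1%:R) * expR (- (v / 2 * (n.+1%:R ^- 2))).
  rewrite RintegralZl//; last first.
    apply: (bounded_integrable _ (M := 1)); last by move=> w; exact: sin_max.
    by apply: (measurableT_comp measurable_sin); exact: measurable_funM.
  under eq_Rintegral do rewrite mulrC.
  rewrite -Rintegral_cosBpihalf wL cosBpihalf mulrA; congr (_ * sin _ * expR _).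
    exact: mulrC.
  by rewrite exprVn; ring.
have c2 : \int[P]_w (n.+1%:R * sin (L w / n.+1%:R)) @[n --> \oo] --> m.
  rewrite (funext E) -[X in _ --> X]mulr1; apply: cvgM; first exact: cvg_natS_sin.
  rewrite -[X in _ --> X](@expR0 R); apply: continuous_cvg; first exact: continuous_expR.
  rewrite -[X in _ --> X](oppr0 R); apply: cvgN.
  rewrite -[X in _ --> X](mulr0 (v / 2)).
  apply: cvgM; first exact: cvg_cst.
  exact: cvg_natS_inv_sqr.
exact: (cvg_unique (@Rhausdorff R) c1 c2).
Qed.

(** 2 n^2 (1 - cos(L / n)) = (2 n sin(L / (2 n)))^2 -> L^2, dominated by L^2,
    while the expectations converge to v by differentiating exp at 0.  So the
    variance parameter of the characteristic function is E(L^2), whatever way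
    the formula was obtained. *)
Lemma second_moment_of_wave L (v : R) : L \in Lfun P 2%:E ->
  (forall u th, \int[P]_w cos (u * L w + th) =
    cos th * expR (- (u ^+ 2 * v / 2))) ->
  \int[P]_w L w ^+ 2 = v.
Proof.
move=> L2 wL; have mL := Lfun_measurable L2.
have iL := Lfun2_integrable_sqr L2.
pose a n : R := 2 * n.+1%:R ^+ 2.
have a0 n : a n != 0 by rewrite mulf_neq0// expf_neq0.
have ca : (a n)^-1 @[n --> \oo] --> (0 : R).
  have E n : (a n)^-1 = 2^-1 * (n.+1%:R ^- 2) by rewrite invfM.
  rewrite (funext E) -[X in _ --> X](mulr0 2^-1); apply: cvgM; first exact: cvg_cst.
  exact: cvg_natS_inv_sqr.
have tE n (y : R) : a n * (1 - cos (n.+1%:R^-1 * y + 0)) =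
    (n.+1%:R * sin (y / 2 / n.+1%:R) * 2) ^+ 2.
  have -> : n.+1%:R^-1 * y + 0 = (y / 2 / n.+1%:R) *+ 2.
    by field; rewrite nat1r pnatr_eq0.
  rewrite cos_mulr2n cos2sin2 /a; ring.
have c1 : \int[P]_w (a n * (1 - cos (n.+1%:R^-1 * L w + 0))) @[n --> \oo] -->
    \int[P]_w (L w ^+ 2).
  apply: (@dominated_cvg_Rintegral _ _ _ P _ _ (fun w => L w ^+ 2)) => //.
  - by move=> n; apply: measurable_funM => //; apply: measurable_funB => //;
      exact: measurable_wave.
  - exact: measurable_funX.
  - apply: aeW => w; rewrite (funext (fun n => tE n (L w))).
    have : n.+1%:R * sin (L w / 2 / n.+1%:R) * 2 @[n --> \oo] --> L w.
      rewrite -[X in _ --> X](@divfK _ (2 : R))//.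
      by apply: cvgM; [exact: cvg_natS_sin|exact: cvg_cst].
    by move=> /[dup] h1 h2; exact: cvgM h1 h2.
  - move=> n w; rewrite tE normrX -(real_normK (num_real (L w))) lerXn2r ?nnegrE//.
    rewrite !normrM (@ger0_norm _ 2)// (@ger0_norm _ n.+1%:R)//.
    rewrite -ler_pdivlMr// -ler_pdivlMl ?ltr0n//.
    apply: (le_trans (normr_sin_le _)).
    by rewrite !normrM !normfV (@ger0_norm _ 2)// (@ger0_norm _ n.+1%:R)// mulrC.
have E n : \int[P]_w (a n * (1 - cos (n.+1%:R^-1 * L w + 0))) =
    a n * (1 - expR (- (v / a n))).
  have iw : P.-integrable setT (EFin \o (fun w => cos (n.+1%:R^-1 * L w + 0))).
    apply: (bounded_integrable _ (M := 1)); last by move=> w; exact: cos_max.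
    exact: measurable_wave.
  have i1 : P.-integrable setT (EFin \o (fun w : T => 1 : R)).
    exact: finite_measure_integrable_cst.
  rewrite RintegralZl//; last first.
    have := integrableB measurableT i1 iw.
    by apply: eq_integrable => // w _ /=; rewrite EFinB.
  rewrite RintegralB// Rintegral_prob_cst wL cos0 mul1r.
  congr (_ * (1 - expR (- _))); rewrite /a; field.
  by rewrite nat1r pnatr_eq0.
rewrite (funext E) in c1.
have c2 := @cvg_mul_1expR R v a a0 ca.
exact: (cvg_unique (@Rhausdorff R) c1 c2).
Qed.

End law.

(** * Centred gaussian variables *)
Section gaussian.
Context {d : measure_display} {T : measurableType d} {R : realType}.
Variable P : probability T R.
Implicit Types L A B : T -> R.

Definition gaussian L := L \in Lfun P 2%:E /\
  forall u th, \int[P]_w cos (u * L w + th) =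
    cos th * expR (- (u ^+ 2 * (\int[P]_w L w ^+ 2) / 2)).

Lemma gaussian_of_wave L (v : R) : L \in Lfun P 2%:E ->
  (forall u th, \int[P]_w cos (u * L w + th) =
    cos th * expR (- (u ^+ 2 * v / 2))) ->
  gaussian L /\ \int[P]_w L w ^+ 2 = v.
Proof.
move=> L2 wL; have E := second_moment_of_wave L2 wL.
by split=> //; split=> // u th; rewrite E.
Qed.

Lemma gaussian_mean L : gaussian L -> \int[P]_w L w = 0.
Proof.
move=> [L2 wL]; apply: (mean_of_wave (v := \int[P]_w L w ^+ 2) L2) => u th.
by rewrite mulr0 add0r.
Qed.

(** The cosine moments converge, hence so does exp(- u^2 v_n / 2) for every u,
    where v_n are the second moments.  The limit E cos(u L) is positive for
    small u, which bounds v_n and makes it converge; the limit of v_n is then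
    E(L^2) by [second_moment_of_wave].  No convergence in L2 is assumed. *)
Lemma gaussian_lim (L_ : nat -> T -> R) L : (forall n, gaussian (L_ n)) ->
  L \in Lfun P 2%:E -> {ae P, forall w, L_ ^~ w @ \oo --> L w} ->
  gaussian L /\ \int[P]_w (L_ n w ^+ 2) @[n --> \oo] --> \int[P]_w (L w ^+ 2).
Proof.
move=> gL L2 cL; have mL := Lfun_measurable L2.
pose v n := \int[P]_w (L_ n w ^+ 2).
have wcv u th : cos th * expR (- (u ^+ 2 * v n / 2)) @[n --> \oo] -->
    \int[P]_w cos (u * L w + th).
  have E n : \int[P]_w cos (u * L_ n w + th) =
    cos th * expR (- (u ^+ 2 * v n / 2)) by case: (gL n) => _ ->.
  rewrite -(funext E); apply: (@bounded_cvg_Rintegral _ _ _ P _ _ 1).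
  - by move=> n; apply: measurable_wave; have [/Lfun_measurable] := gL n.
  - exact: measurable_wave.
  - apply: filterS cL => w cw; apply: continuous_cvg; first exact: continuous_cos.
    by apply: cvgD; [apply: cvgM => //|]; exact: cvg_cst.
  - by move=> n w; exact: cos_max.
(* E cos(L / (m + 1)) tends to 1, so it is positive for some m. *)
have [m m0] : exists m : nat, 0 < \int[P]_w cos (m.+1%:R^-1 * L w + 0).
  have : \int[P]_w cos (m.+1%:R^-1 * L w + 0) @[m --> \oo] --> \int[P]_w (1 : R).
    apply: (@bounded_cvg_Rintegral _ _ _ P _ _ 1) => //.
    - by move=> n; apply: measurable_wave.
    - apply: aeW => w; rewrite -[X in _ --> X](@cos0 R).
      apply: continuous_cvg; first exact: continuous_cos.
      rewrite -[X in _ --> X](addr0 (0 : R)); apply: cvgD; last exact: cvg_cst.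
      have E (n : nat) : n.+1%:R^-1 * L w = L w / n.+1%:R by exact: mulrC.
      rewrite (funext E); exact: cvg_natS_inv.
    - by move=> n w; exact: cos_max.
  rewrite Rintegral_prob_cst => /cvgr_gt/(_ 0 ltr01) [m _ Hm].
  by exists m; apply: Hm => /=.
pose q : R := m.+1%:R^-1.
have q0 : q != 0 by rewrite invr_eq0.
pose c := \int[P]_w cos (q * L w + 0).
have cv : v n @[n --> \oo] --> - (2 / q ^+ 2) * ln c.
  have := wcv q 0; rewrite cos0 -/c => h.
  have {}h : expR (- (q ^+ 2 * v n / 2)) @[n --> \oo] --> c.
    by move: h; under eq_fun do rewrite mul1r.
  have h2 : ln (expR (- (q ^+ 2 * v n / 2))) @[n --> \oo] --> ln c.
    by apply: continuous_cvg h; exact: continuous_ln.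
  have E n : v n = - (2 / q ^+ 2) * ln (expR (- (q ^+ 2 * v n / 2))).
    by rewrite expRK; field.
  by rewrite (funext E); apply: cvgM h2; exact: cvg_cst.
set l := - (2 / q ^+ 2) * ln c in cv.
have wl u th : \int[P]_w cos (u * L w + th) = cos th * expR (- (u ^+ 2 * l / 2)).
  apply: (cvg_unique (@Rhausdorff R) (wcv u th)).
  apply: cvgM; first exact: cvg_cst.
  apply: continuous_cvg; first exact: continuous_expR.
  apply: cvgN; apply: cvgM; last exact: cvg_cst.
  by apply: cvgM => //; exact: cvg_cst.
by have [gl ->] := gaussian_of_wave L2 wl.
Qed.

End gaussian.

Section product.
Context {d1 d2 : measure_display} {T1 : measurableType d1}
  {T2 : measurableType d2} {R : realType}.
Variables (P1 : probability T1 R) (P2 : probability T2 R).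

(** Fubini and the addition formula. *)
Lemma wave_prod (A : T1 -> R) (B : T2 -> R) (th : R) :
  measurable_fun setT A -> measurable_fun setT B ->
  \int[(P1 \x P2)%E]_z cos (A z.1 + B z.2 + th) =
  \int[P1]_x cos (A x) * \int[P2]_y cos (B y + th) -
  \int[P1]_x sin (A x) * \int[P2]_y sin (B y + th).
Proof.
move=> mA mB.
have mAB : measurable_fun setT (fun z : T1 * T2 => cos (A z.1 + B z.2 + th)).
  apply: (measurableT_comp measurable_cos); apply: measurable_funD => //.
  apply: measurable_funD; first exact: measurableT_comp mA measurable_fst.
  exact: measurableT_comp mB measurable_snd.
have iAB : (P1 \x P2)%E.-integrable setT
    (EFin \o (fun z : T1 * T2 => cos (A z.1 + B z.2 + th))).
  apply: (bounded_integrable (P1 \x P2)%E (M := 1) mAB) => z; exact: cos_max.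
have icos d (T : measurableType d) (P : probability T R) (Y : T -> R) :
    measurable_fun setT Y -> P.-integrable setT (EFin \o (fun w => cos (Y w))).
  move=> mY; apply: (bounded_integrable _ (M := 1)); last by move=> w; exact: cos_max.
  exact: measurableT_comp measurable_cos mY.
have isin d (T : measurableType d) (P : probability T R) (Y : T -> R) :
    measurable_fun setT Y -> P.-integrable setT (EFin \o (fun w => sin (Y w))).
  move=> mY; apply: (bounded_integrable _ (M := 1)); last by move=> w; exact: sin_max.
  exact: measurableT_comp measurable_sin mY.
have mBth : measurable_fun setT (fun y => B y + th) by exact: measurable_funD.
rewrite {1}/Rintegral -integral12_prod_meas1//.
pose C := \int[P2]_y cos (B y + th); pose S := \int[P2]_y sin (B y + th).
have E x : fubini_F P2 (EFin \o (fun z : T1 * T2 => cos (A z.1 + B z.2 + th))) x =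
    (cos (A x) * C - sin (A x) * S)%:E.
  rewrite /fubini_F /=.
  have i1 : P2.-integrable setT (EFin \o (fun y => cos (A x) * cos (B y + th))).
    have := integrableZl measurableT (cos (A x)) (icos _ _ P2 _ mBth).
    by apply: eq_integrable => // y _ /=; rewrite EFinM.
  have i2 : P2.-integrable setT (EFin \o (fun y => sin (A x) * sin (B y + th))).
    have := integrableZl measurableT (sin (A x)) (isin _ _ P2 _ mBth).
    by apply: eq_integrable => // y _ /=; rewrite EFinM.
  rewrite -(RintegralZl _ _ (icos _ _ P2 _ mBth))// -(RintegralZl _ _ (isin _ _ P2 _ mBth))//.
  rewrite -RintegralB// /Rintegral fineK; last first.
    by apply: integrable_fin_num => //; have := integrableB measurableT i1 i2;
      apply: eq_integrable => // y _ /=; rewrite EFinB.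
  apply: eq_integral => y _; by rewrite /= -addrA -[in RHS]cosD.
under eq_integral do rewrite E.
rewrite -[LHS]/(\int[P1]_x (cos (A x) * C - sin (A x) * S)).
have j1 : P1.-integrable setT (EFin \o (fun x => cos (A x) * C)).
  have := integrableZr measurableT C (icos _ _ P1 _ mA).
  by apply: eq_integrable => // y _ /=; rewrite EFinM.
have j2 : P1.-integrable setT (EFin \o (fun x => sin (A x) * S)).
  have := integrableZr measurableT S (isin _ _ P1 _ mA).
  by apply: eq_integrable => // y _ /=; rewrite EFinM.
rewrite RintegralB// RintegralZr//; last exact: icos.
by rewrite RintegralZr//; exact: isin.
Qed.

End product.

Lemma sigma_algebraI {U : Type} (S : set (set U)) (A B : set U) :
  sigma_algebra setT S -> S A -> S B -> S (A `&` B).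
Proof.
by move=> /(sigma_algebraP (fun X _ => @subsetT _ X))[_ _ _ SI]; exact: SI.
Qed.

Lemma preimage_sigma_of {U U' I K : Type} {R : realType} (c : I -> U -> R)
    (c' : K -> U' -> R) (h : U' -> U) (e : I -> K) :
  (forall i z, c' (e i) z = c i (h z)) ->
  forall A, sigma_of c A -> sigma_of c' (h @^-1` A).
Proof.
move=> E; apply: sigma_of_sub => [|i r].
  case: (sigma_algebra_sigma_of c') => S0 SC SU; split => /=.
  - by rewrite preimage_set0.
  - by move=> C; rewrite setTD -preimage_setC -setTD; exact: SC.
  - by move=> C SCn; rewrite preimage_bigcup; exact: SU.
rewrite /= (_ : _ @^-1` _ = c' (e i) @^-1` `]r, +oo[).
  exact: sigma_of_preimage.
by apply/seteqP; split => z /=; rewrite in_itv/= andbT E.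
Qed.

Lemma sigma_of_measurable {d : measure_display} {T : measurableType d}
    {R : realType} {I : Type} (f : I -> T -> R) :
  (forall i, measurable_fun setT (f i)) -> sigma_of f `<=` measurable.
Proof.
move=> mf; apply: sigma_of_sub; first exact: sigma_algebra_measurable.
move=> i r; rewrite (_ : [set u | _] = f i @^-1` `]r, +oo[).
  by rewrite -[X in measurable X]setTI; exact: mf.
by apply/seteqP; split => u /=; rewrite in_itv/= andbT.
Qed.

Section gaussian_space.
Context {d : measure_display} {T : measurableType d} {R : realType}.
Variable P : probability T R.
Implicit Types A B L : T -> R.

Lemma Lfun2D A B : A \in Lfun P 2%:E -> B \in Lfun P 2%:E ->
  (fun w => A w + B w) \in Lfun P 2%:E.
Proof.
have p1 : (1 <= (2%:E : \bar R))%E by rewrite lee_fin ler1n.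
by move=> A2 B2; have [_ /(_ A B A2 B2)] := Lfun_addr_closed P p1.
Qed.

Lemma Lfun2Z (a : R) A : A \in Lfun P 2%:E ->
  (fun w => a * A w) \in Lfun P 2%:E.
Proof.
have p1 : 1 <= 2 :> R by rewrite ler1n.
move=> /(Lfun_scale a p1); rewrite (_ : _ \o* _ = (fun w => a * A w))//.
by apply/funext => w /=; rewrite mulrC.
Qed.

Lemma Lfun2_cst0 : (fun=> 0) \in Lfun P 2%:E.
Proof. exact: Lfun_cst. Qed.

Lemma Lfun2_sum {I : Type} (s : seq I) (a : I -> R) (f : I -> T -> R) :
  (forall i, f i \in Lfun P 2%:E) ->
  (fun w => \sum_(i <- s) a i * f i w) \in Lfun P 2%:E.
Proof.
move=> f2; elim: s => [|i s IH].
  rewrite (_ : (fun w => _) = (fun=> 0)); first exact: Lfun2_cst0.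
  by apply/funext => w; rewrite big_nil.
rewrite (_ : (fun w => _) =
    (fun w => a i * f i w + \sum_(i <- s) a i * f i w)).
  exact: Lfun2D (Lfun2Z (a i) (f2 i)) IH.
by apply/funext => w; rewrite big_cons.
Qed.

Lemma Lfun2M_integrable A B : A \in Lfun P 2%:E -> B \in Lfun P 2%:E ->
  P.-integrable setT (EFin \o (fun w => A w * B w)).
Proof. by move=> A2 B2; apply/Lfun1_integrable; exact: Lfun2_mul_Lfun1. Qed.

Lemma RintegralMD_l A B L : A \in Lfun P 2%:E -> B \in Lfun P 2%:E ->
  L \in Lfun P 2%:E ->
  \int[P]_w ((A w + B w) * L w) = \int[P]_w (A w * L w) + \int[P]_w (B w * L w).
Proof.
move=> A2 B2 L2; rewrite -RintegralD//; [|exact: Lfun2M_integrable..].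
by apply: eq_Rintegral => w _; rewrite mulrDl.
Qed.

Lemma RintegralMZ_l a A L : A \in Lfun P 2%:E -> L \in Lfun P 2%:E ->
  \int[P]_w (a * A w * L w) = a * \int[P]_w (A w * L w).
Proof.
move=> A2 L2; rewrite -RintegralZl//; last exact: Lfun2M_integrable.
by apply: eq_Rintegral => w _; rewrite mulrA.
Qed.

Lemma RintegralMC A B : \int[P]_w (A w * B w) = \int[P]_w (B w * A w).
Proof. by apply: eq_Rintegral => w _; rewrite mulrC. Qed.

Lemma RintegralM_suml {I : Type} (s : seq I) (a : I -> R) (f : I -> T -> R) L :
  (forall i, f i \in Lfun P 2%:E) -> L \in Lfun P 2%:E ->
  \int[P]_w ((\sum_(i <- s) a i * f i w) * L w) =
  \sum_(i <- s) a i * \int[P]_w (f i w * L w).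
Proof.
move=> f2 L2; elim: s => [|i s IH].
  under eq_Rintegral do rewrite big_nil mul0r.
  by rewrite big_nil Rintegral_prob_cst.
under eq_Rintegral do rewrite big_cons.
rewrite RintegralMD_l//; [|exact: Lfun2Z|exact: Lfun2_sum].
by rewrite RintegralMZ_l// IH big_cons.
Qed.

Lemma Rintegral_sqrD A B : A \in Lfun P 2%:E -> B \in Lfun P 2%:E ->
  \int[P]_w ((A w + B w) ^+ 2) =
  \int[P]_w (A w ^+ 2) + \int[P]_w (B w ^+ 2) + 2 * \int[P]_w (A w * B w).
Proof.
move=> A2 B2; have AB2 := Lfun2D A2 B2.
under eq_Rintegral do rewrite expr2.
rewrite RintegralMD_l// RintegralMC RintegralMD_l// [X in _ + X]RintegralMC.
rewrite RintegralMD_l// [X in _ + X + _ = _]RintegralMC.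
by under [in RHS]eq_Rintegral do rewrite expr2; ring.
Qed.

(** The two coordinates of T * T carry independent copies of A and B. *)
Lemma gaussian_copies A B : gaussian P A -> gaussian P B ->
  forall u th, \int[(P \x P)%E]_z cos (u * (A z.1 + B z.2) + th) =
    cos th * expR (- (u ^+ 2 *
      (\int[P]_w (A w ^+ 2) + \int[P]_w (B w ^+ 2)) / 2)).
Proof.
move=> gA gB u th.
have [/Lfun_measurable mA wA] := gA; have [/Lfun_measurable mB wB] := gB.
under eq_Rintegral do rewrite mulrDr.
rewrite (@wave_prod _ _ _ _ _ P P (fun w => u * A w) (fun w => u * B w)); last 2 first.
- exact: measurable_funM.
- exact: measurable_funM.
have EA : \int[P]_w cos (u * A w) =
    expR (- (u ^+ 2 * (\int[P]_w (A w ^+ 2)) / 2)).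
  have := wA u 0; rewrite cos0 mul1r => <-.
  by apply: eq_Rintegral => w _; rewrite addr0.
have SA : \int[P]_w sin (u * A w) = 0.
  by rewrite -Rintegral_cosBpihalf wA cosN cos_pihalf mul0r.
rewrite wB EA SA mul0r subr0.
rewrite mulrCA -expRD; congr (_ * expR _); ring.
Qed.

(** The assumption expresses, on the level of characteristic functions, that A
    and B are independent.  The variance of A + B, computed in two ways, shows
    that they are orthogonal. *)
Lemma gaussian_add A B : gaussian P A -> gaussian P B ->
  (forall u th, \int[P]_w cos (u * (A w + B w) + th) =
    \int[(P \x P)%E]_z cos (u * (A z.1 + B z.2) + th)) ->
  gaussian P (fun w => A w + B w) /\ \int[P]_w (A w * B w) = 0.
Proof.
move=> gA gB H; have [A2 _] := gA; have [B2 _] := gB.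
have [||gAB] := @gaussian_of_wave _ _ _ P (fun w => A w + B w)
  (\int[P]_w (A w ^+ 2) + \int[P]_w (B w ^+ 2)).
- exact: Lfun2D.
- by move=> u th; rewrite H gaussian_copies.
rewrite Rintegral_sqrD// -[RHS]addr0 => /addrI/eqP.
by rewrite mulf_eq0 pnatr_eq0/= => /eqP.
Qed.

(** Under P the family (f, g) sits on the diagonal of T * T, under P x P its two
    halves are independent copies.  Orthogonality makes the characteristic
    functions of both agree, and [same_law] compares the probabilities of the
    rectangle A x B. *)
Lemma gaussian_orth_indep {I J : finType} (f : I -> T -> R) (g : J -> T -> R) :
  (forall a b, gaussian P (fun w => \sum_i a i * f i w + \sum_j b j * g j w)) ->
  (forall i, f i \in Lfun P 2%:E) -> (forall j, g j \in Lfun P 2%:E) ->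
  (forall i j, \int[P]_w (f i w * g j w) = 0) ->
  forall A B : set T, sigma_of f A -> sigma_of g B -> P (A `&` B) = (P A * P B)%E.
Proof.
move=> gfg f2 g2 fg0 A B sA sB.
have gf a : gaussian P (fun w => \sum_i a i * f i w).
  have := gfg a (fun=> 0); congr gaussian; apply/funext => w.
  by rewrite [X in _ + X]big1 ?addr0// => j _; rewrite mul0r.
have gg b : gaussian P (fun w => \sum_j b j * g j w).
  have := gfg (fun=> 0) b; congr gaussian; apply/funext => w.
  by rewrite big1 ?add0r// => i _; rewrite mul0r.
have mf i := Lfun_measurable (f2 i); have mg j := Lfun_measurable (g2 j).
pose c (k : I + J) (z : T * T) : R :=
  match k with inl i => f i z.1 | inr j => g j z.2 end.
pose diag (w : T) := (w, w).
have mc1 k : measurable_fun setT (c k \o diag) by case: k.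
have mc2 k : measurable_fun setT (c k \o id).
  case: k => k /=; first exact: measurableT_comp (mf k) measurable_fst.
  exact: measurableT_comp (mg k) measurable_snd.
have cE a (x y : T) : \sum_k a k * c k (x, y) =
    \sum_i a (inl i) * f i x + \sum_j a (inr j) * g j y.
  by rewrite big_sumType.
have same a th : \int[P]_w wave c a th (diag w) =
    \int[(P \x P)%E]_z wave c a th (id z).
  pose F w := \sum_i a (inl i) * f i w; pose G w := \sum_j a (inr j) * g j w.
  have -> : \int[P]_w wave c a th (diag w) = \int[P]_w cos (1 * (F w + G w) + th).
    by apply: eq_Rintegral => w _; rewrite /wave cE mul1r.
  have -> : \int[(P \x P)%E]_z wave c a th z =
      \int[(P \x P)%E]_z cos (1 * (F z.1 + G z.2) + th).
    by apply: eq_Rintegral => -[x y] _; rewrite /wave cE mul1r.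
  have F2 : F \in Lfun P 2%:E by exact: Lfun2_sum.
  have G2 : G \in Lfun P 2%:E by exact: Lfun2_sum.
  have FG0 : \int[P]_w (F w * G w) = 0.
    rewrite RintegralM_suml// big1// => i _; rewrite RintegralMC RintegralM_suml//.
    by rewrite big1 ?mulr0// => j _; rewrite RintegralMC fg0 mulr0.
  rewrite (gaussian_copies (gf (a \o inl)) (gg (a \o inr))).
  have [_ ->] := gfg (a \o inl) (a \o inr).
  by rewrite (Rintegral_sqrD F2 G2) FG0 mulr0 addr0.
have := @same_law _ _ _ _ _ P (P \x P)%E _ diag id _ c mc1 mc2 same
  (fst @^-1` A `&` snd @^-1` B).
case.
  apply: (sigma_algebraI (sigma_algebra_sigma_of c)).
    by apply: (@preimage_sigma_of _ _ _ _ _ f c fst inl).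
  by apply: (@preimage_sigma_of _ _ _ _ _ g c snd inr).
move=> _ _.
rewrite [X in _ = (P \x P)%E X -> _](_ : _ = A `*` B); last first.
  by apply/seteqP; split => -[].
rewrite product_measure1E//.
- exact: sigma_of_measurable mf _ sA.
- exact: sigma_of_measurable mg _ sB.
Qed.

End gaussian_space.

(** * Linear functionals of random vectors *)
Section random_vectors.
Context {d : measure_display} {T : measurableType d} {R : realType}.
Context {K : nat}.
Variable P : probability T R.
Implicit Types (X Y : T -> 'cV[R]_K) (a b : 'rV[R]_K).

Lemma borel_cVE : @borel_cV R K = sigma_of (fun i (v : 'cV[R]_K) => v i 0).
Proof.
rewrite /borel_cV /g_sigma_preimage /sigma_of -bigcup_seq/=; congr (<<s _ >>).
by apply/seteqP; split => A [i _ Ai]; exists i => //=; rewrite mem_index_enum.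
Qed.

Lemma borel_cVI A B : @borel_cV R K A -> borel_cV B -> borel_cV (A `&` B).
Proof.
by rewrite borel_cVE; apply: sigma_algebraI; exact: sigma_algebra_sigma_of.
Qed.

Lemma borel_cVT : borel_cV [set: 'cV[R]_K].
Proof.
rewrite borel_cVE; have [S0 SC _] := sigma_algebra_sigma_of
  (fun i (v : 'cV[R]_K) => v i 0).
by have := SC _ S0; rewrite setTD setC0.
Qed.

Definition dot a X : T -> R := fun w => (a *m X w) 0 0.

Lemma dotE a X w : dot a X w = \sum_i a 0 i * component X i w.
Proof. by rewrite /dot mxE. Qed.

Lemma dot_Lfun2 a X : square_integrable P X -> dot a X \in Lfun P 2%:E.
Proof.
move=> X2; have := @Lfun2_sum _ _ _ P _ (index_enum 'I_K) (a 0) (component X) X2.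
rewrite (_ : (fun w => _) = dot a X)//.
by apply/funext => w; rewrite dotE.
Qed.

Lemma measurable_component X i : square_integrable P X ->
  measurable_fun setT (component X i).
Proof. by move=> X2; exact: Lfun_measurable (X2 i). Qed.

Lemma measurable_preimage_borel X A : square_integrable P X -> borel_cV A ->
  measurable (X @^-1` A).
Proof.
move=> X2; rewrite borel_cVE => bA.
apply: (@sigma_of_measurable _ _ _ _ (component X)).
  by move=> i; exact: measurable_component.
exact: (@preimage_sigma_of _ _ _ _ _ _ (component X) X id _ _ bA).
Qed.

(** The location parameter of the normal law of a X is its mean, which is 0. *)
Lemma dot_gaussian a X : square_integrable P X -> mean_vec P X = 0 ->
  multivariate_normal P X -> gaussian P (dot a X).
Proof.
move=> X2 X0 nX; have [m [s lX]] := nX a.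
have a2 := dot_Lfun2 a X2; have ma := Lfun_measurable a2.
have wX := normal_law_wave ma lX.
have m0 : m = 0.
  rewrite -(mean_of_wave a2 wX).
  have -> : \int[P]_w dot a X w =
      \int[P]_w ((\sum_i a 0 i * component X i w) * cst 1 w).
    by apply: eq_Rintegral => w _; rewrite dotE mulr1.
  rewrite (@RintegralM_suml _ _ _ P _ _ (a 0) (component X) (cst 1))//; last first.
    exact: Lfun_cst.
  rewrite big1// => i _.
  have /matrixP/(_ i 0) := X0; rewrite !mxE unlock => Xi.
  by under eq_Rintegral do rewrite mulr1; rewrite /Rintegral Xi mulr0.
have [|//] := @gaussian_of_wave _ _ _ P (dot a X) (s ^+ 2) a2.
by move=> u th; rewrite wX m0 mulr0 add0r.
Qed.

End random_vectors.

(** * The gaussian space of an independent sequence *)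
Section linear_combinations.
Context {d : measure_display} {T : measurableType d} {R : realType}.
Context {K : nat}.
Variable P : probability T R.
Variable Z : int -> T -> 'cV[R]_K.
Hypothesis Z2 : forall t, square_integrable P (Z t).
Hypothesis indepZ : mutually_indep P Z.
Hypothesis gaussZ : forall t a, gaussian P (dot a (Z t)).

Definition lincomb (r : {fset int}) (a : int -> 'rV[R]_K) : T -> R :=
  fun w => \sum_(q <- r) dot (a q) (Z q) w.

Lemma lincomb_Lfun2 r a : lincomb r a \in Lfun P 2%:E.
Proof.
have := @Lfun2_sum _ _ _ P _ (r : seq int) (fun=> 1) (fun q => dot (a q) (Z q)).
rewrite (_ : (fun w => _) = lincomb r a); last first.
  by apply/funext => w; apply: eq_bigr => q _; rewrite mul1r.
by apply => q; exact: dot_Lfun2.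
Qed.

(** The events depending on Z_q, q in r, and those depending on Z_s are
    independent: this is assumed for rectangles, which form a pi-system.  So the
    sum has the same law on T under P as the sum of the independent copies on
    T * T under P x P. *)
Lemma lincomb_copies (r : {fset int}) a (s : int) b : s \notin r -> forall u th,
  \int[P]_w cos (u * (lincomb r a w + dot b (Z s) w) + th) =
  \int[(P \x P)%E]_z cos (u * (lincomb r a z.1 + dot b (Z s) z.2) + th).
Proof.
move=> sr u th.
(* Rectangles: a condition D q on each Z_q with the first coordinate, and a
   condition E on Z_s with the second one. *)
pose rect (D : int -> set 'cV[R]_K) (E : set 'cV[R]_K) :=
  (\bigcap_(q in [set` r]) (Z q @^-1` D q)) `*` (Z s @^-1` E).
pose G := [set C | exists D E,
  [/\ forall q, borel_cV (D q), borel_cV E & C = rect D E]].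
have GI : setI_closed G.
  move=> _ _ [D [E [bD bE ->]]] [D' [E' [bD' bE' ->]]].
  exists (fun q => D q `&` D' q), (E `&` E'); split.
  - by move=> q; exact: borel_cVI.
  - exact: borel_cVI.
  apply/seteqP; split => -[x y] /=.
    move=> [[Dx Ey] [Dx' Ey']]; split => //= q qr.
    by split; [exact: Dx|exact: Dx'].
  move=> [Dx [Ey Ey']]; split; split => //= q qr.
    by have [] := Dx q qr.
  by have [] := Dx q qr.
pose diag (w : T) := (w, w).
have Gsame : G `<=` same_prob P (P \x P)%E diag id.
  move=> _ [D [E [bD bE ->]]].
  have mD : measurable (\bigcap_(q in [set` r]) (Z q @^-1` D q)).
    rewrite bigcap_fset; apply: bigsetI_measurable => q _.
    exact: measurable_preimage_borel.
  have mE : measurable (Z s @^-1` E) by exact: measurable_preimage_borel.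
  rewrite /same_prob.
  have -> : diag @^-1` rect D E =
    (\bigcap_(q in [set` r]) (Z q @^-1` D q)) `&` (Z s @^-1` E) by [].
  split; [exact: measurableI|exact: measurableX|].
  rewrite preimage_id /rect.
  transitivity (P (\bigcap_(q in [set` r]) (Z q @^-1` D q)) *
    P (Z s @^-1` E))%E; last exact/esym/product_measure1E.
  (* Mutual independence over s |` r and over r. *)
  pose B q := if q == s then E else D q.
  have := @indepZ (s |` r)%fset B.
  have BsE : B s = E by rewrite /B eqxx.
  rewrite big_fsetU1//= BsE.
  have -> : \bigcap_(t in [set` (s |` r)%fset]) (Z t @^-1` B t) =
      \bigcap_(q in [set` r]) (Z q @^-1` D q) `&` Z s @^-1` E.
    apply/seteqP; split => w /=.
      move=> H; split.
        move=> q qr; have := H q; rewrite /= fset1Ur// /B => /(_ isT).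
        have qs : q != s by apply: contraNneq sr => <-.
        by rewrite (negbTE qs).
      by have := H s; rewrite /= fset1U1 /B eqxx; exact.
    move=> [H1 H2] q; rewrite /= in_fset1U /B.
    by have [->|qs] := eqVneq q s => //= qr; exact: H1.
  move=> ->; last by move=> q _; rewrite /B; case: ifP.
  rewrite muleC; congr (_ * _)%E; rewrite (@indepZ r D)//.
  apply: eq_fbigr => q qr _; rewrite /B ifF//.
  by apply/negbTE; apply: contraNneq sr => <-.
(* It remains to see that the sum is measurable for the sigma-algebra of the
   rectangles, which holds for each of its coordinates. *)
have sub := same_prob_sigma GI Gsame.
have mcoord (q : int) (i : 'I_K) : q \in r ->
    measurable_fun setT (fun z : g_sigma_algebraType G => component (Z q) i z.1).
  move=> qr _ C mC; rewrite setTI; apply: sub_sigma_algebra.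
  exists (fun t => if t == q then [set v | C (v i 0)] else setT), setT; split.
  - move=> t; case: ifP => _; last exact: borel_cVT.
    by rewrite borel_cVE; exact: (@sigma_of_preimage _ _ _ (fun i (v : 'cV[R]_K) => v i 0)).
  - exact: borel_cVT.
  apply/seteqP; split => -[x y] /=.
    by move=> Cx; split => //= t tr; case: ifP => // /eqP ->.
  by move=> [/(_ q qr)]; rewrite /= eqxx.
have mcoord2 (i : 'I_K) :
    measurable_fun setT (fun z : g_sigma_algebraType G => component (Z s) i z.2).
  move=> _ C mC; rewrite setTI; apply: sub_sigma_algebra.
  exists (fun=> setT), [set v | C (v i 0)]; split.
  - by move=> t; exact: borel_cVT.
  - by rewrite borel_cVE; exact: (@sigma_of_preimage _ _ _ (fun i (v : 'cV[R]_K) => v i 0)).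
  by apply/seteqP; split => -[x y] //= [].
pose Y (z : T * T) := lincomb r a z.1 + dot b (Z s) z.2.
have mY : measurable_fun setT (Y : g_sigma_algebraType G -> R).
  apply: measurable_funD.
    rewrite /lincomb.
    have -> : (fun z : g_sigma_algebraType G => \sum_(q <- r) dot (a q) (Z q) z.1) =
       (fun z => \sum_(q <- r) if q \in r then dot (a q) (Z q) z.1 else 0).
      by apply/funext => z; apply: eq_fbigr => q ->.
    apply: measurable_sum => q; have [qr|_] := boolP (q \in r);
      last exact: measurable_cst.
    under eq_fun do rewrite dotE.
    by apply: measurable_sum => i; apply: measurable_funM => //; exact: mcoord.
  under eq_fun do rewrite dotE.
  by apply: measurable_sum => i; apply: measurable_funM.
have mlincomb := Lfun_measurable (lincomb_Lfun2 r a).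
have mdot := Lfun_measurable (dot_Lfun2 b (Z2 s)).
apply: (@Rintegral_eq_law _ _ _ _ _ P (P \x P)%E
  (fun w => lincomb r a w + dot b (Z s) w) Y (fun y => cos (u * y + th)) 1).
- exact: measurable_funD.
- apply: measurable_funD; first exact: measurableT_comp mlincomb measurable_fst.
  exact: measurableT_comp mdot measurable_snd.
- exact: measurable_wave.
- by move=> y; exact: cos_max.
- move=> B mB; have := mY measurableT B mB; rewrite setTI => /sub[_ _].
  by rewrite preimage_id.
Qed.

Lemma lincomb_gaussian r a : gaussian P (lincomb r a).
Proof.
move: {2}#|` r| (erefl #|` r|) => n; elim: n r => [|n IH] r.
  move=> /cardfs0_eq ->; rewrite /lincomb.
  have [|] := @gaussian_of_wave _ _ _ P (fun=> 0) 0 (Lfun2_cst0 P).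
    move=> u th; under eq_Rintegral do rewrite mulr0 add0r.
    by rewrite Rintegral_prob_cst mulr0 mul0r oppr0 expR0 mulr1.
  by move=> + _; congr gaussian; apply/funext => w; rewrite big_seq_fset0.
move=> cr; have /fset0Pn [s sr] : r != fset0 by rewrite -cardfs_gt0 cr.
have := cr; rewrite (cardfsD1 s) sr => -[] /IH gr.
have sr' : s \notin (r `\ s)%fset by rewrite !inE eqxx.
have [+ _] := gaussian_add gr (gaussZ s (a s)) (lincomb_copies a (a s) sr').
by congr gaussian; apply/funext => w; rewrite /lincomb (big_fsetD1 s sr)/= addrC.
Qed.

Lemma lincomb_orth (r : {fset int}) a (s : int) b : s \notin r ->
  gaussian P (fun w => lincomb r a w + dot b (Z s) w) /\
  \int[P]_w (lincomb r a w * dot b (Z s) w) = 0.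
Proof.
move=> sr.
exact: gaussian_add (lincomb_gaussian r a) (gaussZ s b) (lincomb_copies a b sr).
Qed.

End linear_combinations.

Lemma cvg_sumr {R : realType} {I : Type} (s : seq I) (f : I -> nat -> R)
    (l : I -> R) : (forall i, f i @ \oo --> l i) ->
  \sum_(i <- s) f i n @[n --> \oo] --> \sum_(i <- s) l i.
Proof.
move=> cf; elim: s => [|i s IH].
  rewrite big_nil; apply: cvg_near_cst; apply: nearW => n.
  by rewrite big_nil.
rewrite big_cons; have E n : \sum_(j <- i :: s) f j n = f i n + \sum_(j <- s) f j n.
  by rewrite big_cons.
by rewrite (funext E); exact: cvgD.
Qed.

Section closure.
Context {d : measure_display} {T : measurableType d} {R : realType}.
Context {K : nat}.
Variable P : probability T R.
Variable Z : int -> T -> 'cV[R]_K.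
Hypothesis Z2 : forall t, square_integrable P (Z t).
Hypothesis indepZ : mutually_indep P Z.
Hypothesis gaussZ : forall t a, gaussian P (dot a (Z t)).
Implicit Types (Q : int -> bool) (L M : T -> R).

Lemma dotD a b (X : T -> 'cV[R]_K) w : dot (a + b) X w = dot a X w + dot b X w.
Proof. by rewrite /dot mulmxDl mxE. Qed.

Lemma dotZ k a (X : T -> 'cV[R]_K) w : dot (k *: a) X w = k * dot a X w.
Proof. by rewrite /dot -scalemxAl mxE. Qed.

Lemma dot0 (X : T -> 'cV[R]_K) w : dot 0 X w = 0.
Proof. by rewrite /dot mul0mx mxE. Qed.

Lemma lincomb_widen (r r' : {fset int}) a : (r `<=` r')%fset ->
  lincomb Z r a = lincomb Z r' (fun q => if q \in r then a q else 0).
Proof.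
move=> rr'; apply/funext => w; rewrite /lincomb.
transitivity (\sum_(q <- r) dot (if q \in r then a q else 0) (Z q) w).
  by apply: eq_fbigr => q ->.
apply: big_fset_incl => // q _ /negbTE ->; exact: dot0.
Qed.

Lemma lincombD (r1 r2 : {fset int}) a1 a2 : exists a,
  (fun w => lincomb Z r1 a1 w + lincomb Z r2 a2 w) = lincomb Z (r1 `|` r2)%fset a.
Proof.
exists (fun q => (if q \in r1 then a1 q else 0) + (if q \in r2 then a2 q else 0)).
rewrite (@lincomb_widen r1 _ _ (fsubsetUl r1 r2)) (@lincomb_widen r2 _ _ (fsubsetUr r1 r2)).
by apply/funext => w; rewrite /lincomb -big_split/=; apply: eq_bigr => q _; rewrite dotD.
Qed.

Lemma lincombZ k (r : {fset int}) a :
  (fun w => k * lincomb Z r a w) = lincomb Z r (fun q => k *: a q).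
Proof.
by apply/funext => w; rewrite /lincomb mulr_sumr; apply: eq_bigr => q _; rewrite dotZ.
Qed.

(** Q restricts the times that may occur; [fun q => q <= t] describes what is
    known at time t. *)
Definition closed_span Q L := L \in Lfun P 2%:E /\
  exists (r : nat -> {fset int}) (a : nat -> int -> 'rV[R]_K),
    (forall n q, q \in r n -> Q q) /\
    {ae P, forall w, (fun n => lincomb Z (r n) (a n) w) @ \oo --> L w}.

Lemma closed_spanD Q L M : closed_span Q L -> closed_span Q M ->
  closed_span Q (fun w => L w + M w).
Proof.
move=> [L2 [r [a [rQ cL]]]] [M2 [s [b [sQ cM]]]]; split; first exact: Lfun2D.
have /choice [e eE] : forall n, exists e,
    (fun w => lincomb Z (r n) (a n) w + lincomb Z (s n) (b n) w) =
    lincomb Z (r n `|` s n)%fset e by move=> n; exact: lincombD.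
exists (fun n => (r n `|` s n)%fset), e; split.
  by move=> n q; rewrite in_fsetU => /orP[/rQ|/sQ].
apply: filterS2 cL cM => w cL cM.
have E n : lincomb Z (r n `|` s n)%fset (e n) w =
    lincomb Z (r n) (a n) w + lincomb Z (s n) (b n) w by rewrite -eE.
by rewrite (funext E); exact: cvgD.
Qed.

Lemma closed_spanZ Q k L : closed_span Q L -> closed_span Q (fun w => k * L w).
Proof.
move=> [L2 [r [a [rQ cL]]]]; split; first exact: Lfun2Z.
exists r, (fun n q => k *: a n q); split => //.
apply: filterS cL => w cL.
have E n : lincomb Z (r n) (fun q => k *: a n q) w = k * lincomb Z (r n) (a n) w.
  by rewrite -lincombZ.
by rewrite (funext E); apply: cvgM => //; exact: cvg_cst.
Qed.

Lemma closed_span0 Q : closed_span Q (fun=> 0).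
Proof.
split; first exact: Lfun2_cst0.
exists (fun=> fset0), (fun _ _ => 0); split => //.
by apply: aeW => w; rewrite /lincomb big_seq_fset0; exact: cvg_cst.
Qed.

Lemma closed_span_sum Q {I : Type} (s : seq I) (a : I -> R) (f : I -> T -> R) :
  (forall i, closed_span Q (f i)) -> closed_span Q (fun w => \sum_(i <- s) a i * f i w).
Proof.
move=> cf; elim: s => [|i s IH].
  rewrite (_ : (fun w => _) = (fun=> 0)); first exact: closed_span0.
  by apply/funext => w; rewrite big_nil.
rewrite (_ : (fun w => _) =
    (fun w => a i * f i w + \sum_(i <- s) a i * f i w)).
  by apply: closed_spanD => //; exact: closed_spanZ.
by apply/funext => w; rewrite big_cons.
Qed.

Lemma closed_span_weaken Q Q' L : (forall q, Q q -> Q' q) ->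
  closed_span Q L -> closed_span Q' L.
Proof.
move=> QQ' [L2 [r [a [rQ cL]]]]; split=> //; exists r, a; split=> // n q /rQ.
exact: QQ'.
Qed.

Lemma closed_span_gaussian Q L : closed_span Q L -> gaussian P L.
Proof.
move=> [L2 [r [a [_ cL]]]].
by have [] := gaussian_lim (fun n => lincomb_gaussian Z2 indepZ gaussZ (r n) (a n)) L2 cL.
Qed.

(** For approximations L_n the variance of L_n + b Z_s is the sum of the
    variances, and by [gaussian_lim] this passes to the limit. *)
Lemma closed_span_orth Q L s b : closed_span Q L -> ~~ Q s ->
  \int[P]_w (L w * dot b (Z s) w) = 0.
Proof.
move=> [L2 [r [a [rQ cL]]]] Qs.
have sr n : s \notin r n by apply: contra Qs => /rQ.
have b2 := dot_Lfun2 b (Z2 s).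
have gl n := lincomb_gaussian Z2 indepZ gaussZ (r n) (a n).
have glb n := lincomb_orth Z2 indepZ gaussZ (a n) b (sr n).
have [_ c1] := gaussian_lim gl L2 cL.
have [] := @gaussian_lim _ _ _ P
  (fun n w => lincomb Z (r n) (a n) w + dot b (Z s) w) (fun w => L w + dot b (Z s) w).
- by move=> n; case: (glb n).
- exact: Lfun2D.
- by apply: filterS cL => w cL; apply: cvgD => //; exact: cvg_cst.
move=> _ c2.
have E n : \int[P]_w ((lincomb Z (r n) (a n) w + dot b (Z s) w) ^+ 2) =
    \int[P]_w (lincomb Z (r n) (a n) w ^+ 2) + \int[P]_w (dot b (Z s) w ^+ 2).
  rewrite Rintegral_sqrD//; last exact: lincomb_Lfun2.
  by have [_ ->] := glb n; rewrite mulr0 addr0.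
rewrite (funext E) in c2.
have c3 : \int[P]_w (lincomb Z (r n) (a n) w ^+ 2) + \int[P]_w (dot b (Z s) w ^+ 2)
    @[n --> \oo] --> \int[P]_w (L w ^+ 2) + \int[P]_w (dot b (Z s) w ^+ 2).
  by apply: cvgD => //; exact: cvg_cst.
have : \int[P]_w ((L w + dot b (Z s) w) ^+ 2) =
    \int[P]_w (L w ^+ 2) + \int[P]_w (dot b (Z s) w ^+ 2).
  exact: (cvg_unique (@Rhausdorff R) c2 c3).
by rewrite Rintegral_sqrD// => E1; lra.
Qed.

Lemma closed_span_orth_indep {I J : finType} (f : I -> T -> R) (g : J -> T -> R) :
  (forall i, closed_span predT (f i)) -> (forall j, closed_span predT (g j)) ->
  (forall i j, \int[P]_w (f i w * g j w) = 0) ->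
  forall A B : set T, sigma_of f A -> sigma_of g B -> P (A `&` B) = (P A * P B)%E.
Proof.
move=> cf cg fg0; apply: gaussian_orth_indep => //.
- move=> a b; apply: (@closed_span_gaussian predT).
  by apply: closed_spanD; exact: closed_span_sum.
- by move=> i; case: (cf i).
- by move=> i; case: (cg i).
Qed.

(** The partial sums of the series only involve the times t, t - 1, ... *)
Lemma closed_span_series (X : T -> 'cV[R]_K) (t : int) (Psi : nat -> 'M[R]_K) b :
  square_integrable P X ->
  {ae P, forall w, series (fun j => Psi j *m Z (t - j%:Z) w) @ \oo --> X w} ->
  closed_span (fun q => q <= t) (dot b X).
Proof.
move=> X2 cX; split; first exact: dot_Lfun2.
pose a (q : int) := b *m Psi `|(t - q)%R|%N.
have /choice [r rE] : forall n : nat, exists r : {fset int},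
    (forall q, q \in r -> t - n%:Z < q <= t) /\
    forall w, lincomb Z r a w = (b *m series (fun j => Psi j *m Z (t - j%:Z) w) n) 0 0.
  elim=> [|n [r [rn rE]]].
    exists fset0; split => [q|w]; first by rewrite in_fset0.
    by rewrite /lincomb big_seq_fset0 /series/= big_geq// mulmx0 mxE.
  exists ((t - n%:Z) |` r)%fset; split.
    move=> q; rewrite in_fset1U => /orP[/eqP ->|/rn /andP[q1 q2]]; first by lia.
    by lia.
  move=> w; rewrite /lincomb big_fsetU1/=; last first.
    by apply/negP => /rn; rewrite ltxx.
  rewrite -/(lincomb Z r a w) rE seriesS mulmxDr [RHS]mxE; congr (_ + _).
  have aE : a (t - n%:Z) = b *m Psi n by rewrite /a; congr (_ *m Psi _); lia.
  by rewrite /dot aE mulmxA.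
exists r, (fun=> a); split => [n q /(rE n).1 /andP[]//|].
apply: filterS cX => w cX.
have E n : lincomb Z (r n) a w =
    \sum_i b 0 i * (series (fun j => Psi j *m Z (t - j%:Z) w) n) i 0.
  by rewrite (rE n).2 mxE.
rewrite (funext E) dotE.
apply: cvg_sumr => i; apply: cvgM; first exact: cvg_cst.
have h : continuous (fun M : 'cV[R]_K => M i 0) by exact: coord_continuous.
exact: (cvg_comp _ _ cX (h (X w))).
Qed.

End closure.

(** * Time reversal *)
Lemma fset_minimum (J : {fset int}) : J != fset0 ->
  exists2 t, t \in J & forall s, s \in J -> t <= s.
Proof.
move: {2}#|` J| (erefl #|` J|) => n; elim: n J => [|n IH] J.
  by move=> /cardfs0_eq ->; rewrite eqxx.
move=> cJ /fset0Pn [x xJ].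
have [J0|] := eqVneq (J `\ x)%fset fset0.
  exists x => // s sJ; have [->//|sx] := eqVneq s x.
  have : s \in (J `\ x)%fset by rewrite !inE sx.
  by rewrite J0 in_fset0.
have := cJ; rewrite (cardfsD1 x) xJ => -[] /IH /[apply] -[t].
rewrite !inE => /andP[tx tJ] tmin.
have tle s : s \in J -> s != x -> t <= s by move=> sJ sx; apply: tmin; rewrite !inE sx.
have [xt|tx'] := leP x t.
  exists x => // s sJ; have [->//|sx] := eqVneq s x.
  exact: le_trans xt (tle s sJ sx).
by exists t => // s sJ; have [->|/tle->//] := eqVneq s x; exact: ltW.
Qed.

Section second_moments.
Context {d : measure_display} {T : measurableType d} {R : realType}.
Context {K : nat}.
Variable P : probability T R.
Implicit Types X Y : T -> 'cV[R]_K.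

Lemma component_dot X i : component X i = dot (delta_mx 0 i) X.
Proof. by apply/funext => w; rewrite /dot -rowE mxE. Qed.

(** The product of the means vanishes as soon as X is centred. *)
Lemma second_moment_dot X Y a b :
  square_integrable P X -> square_integrable P Y ->
  (forall i, \int[P]_w component X i w = 0) ->
  \int[P]_w (dot a X w * dot b Y w) = (a *m cov_mx P X Y *m b^T) 0 0.
Proof.
move=> X2 Y2 X0.
have E i j : \int[P]_w (component X i w * component Y j w) = cov_mx P X Y i j.
  rewrite mxE covarianceE.
  - have -> : 'E_P[component X i]%E = 0%E.
      rewrite unlock -[LHS]fineK; first by rewrite -[fine _]/(\int[P]_w component X i w) X0.
      by apply: integrable_fin_num => //; exact: Lfun2_integrable.
    by rewrite mul0e sube0 unlock.
  - by apply/Lfun1_integrable; exact: Lfun2_integrable.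
  - by apply/Lfun1_integrable; exact: Lfun2_integrable.
  - exact: Lfun2_mul_Lfun1.
have -> : \int[P]_w (dot a X w * dot b Y w) =
    \int[P]_w ((\sum_i a 0 i * component X i w) * dot b Y w).
  by apply: eq_Rintegral => w _; rewrite dotE.
rewrite RintegralM_suml//; last exact: dot_Lfun2.
rewrite -mulmxA mxE; apply: eq_bigr => i _; congr (_ * _).
rewrite RintegralMC.
have -> : \int[P]_w (dot b Y w * component X i w) =
    \int[P]_w ((\sum_j b 0 j * component Y j w) * component X i w).
  by apply: eq_Rintegral => w _; rewrite dotE.
rewrite RintegralM_suml// mxE; apply: eq_bigr => j _.
by rewrite RintegralMC E mulrC; congr (_ * _); rewrite [RHS]mxE.
Qed.

End second_moments.

Unset Implicit Arguments.

Theorem proposition3 (d : measure_display) (T : measurableType d)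
    (R : realType) (P : probability T R) (K : nat)
    (Phi : 'M[R]_K) (X Z : int -> T -> 'cV[R]_K) (Gamma0 : 'M[R]_K)
    (hVAR : VAR1 P Phi X Z)
    (hcausal : causal P X Z)
    (hnormal : forall t, multivariate_normal P (Z t))
    (hGamma0 : forall t, Gamma0 = cov_mx P (X t) (X t))
    (hrank : \rank Gamma0 = K) :
  exists (Phi' : 'M[R]_K) (Z' : int -> T -> 'cV[R]_K),
    [/\ iid_white_noise P Z',
        forall t, {ae P, forall w, X t w = Phi' *m X (t + 1) w + Z' t w} &
        forall t i, t < i -> indep_vec P (Z' t) (X i)].
Proof.
have [[X2 _ covX] [indepZ _ Z2 Z0] eqX] := hVAR.
have [Psi [_ serX]] := hcausal.
have gaussZ t a : gaussian P (dot a (Z t)) by exact: dot_gaussian.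
have closX t b : closed_span P Z (fun q => q <= t) (dot b (X t)).
  exact: closed_span_series (serX t).
have mean0 t i : \int[P]_w component (X t) i w = 0.
  rewrite component_dot; apply: gaussian_mean.
  exact: (closed_span_gaussian Z2 indepZ gaussZ (closX t _)).
have G0u : Gamma0 \in unitmx by rewrite -row_full_unit /row_full hrank.
pose Gamma1 := cov_mx P (X 0) (X (0 + 1)).
have G1E t : cov_mx P (X t) (X (t + 1)) = Gamma1 by exact: covX.
pose Phi' := Gamma1 *m invmx Gamma0.
pose Z' (t : int) w := X t w - Phi' *m X (t + 1) w.
have dotZ' t b w : dot b (Z' t) w = dot b (X t) w + dot (- (b *m Phi')) (X (t + 1)) w.
  by rewrite /dot /Z' mulmxBr mulNmx mulmxA mxE.
have closZ' t b : closed_span P Z (fun q => q <= t + 1) (dot b (Z' t)).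
  rewrite (funext (dotZ' t b)); apply: closed_spanD; last exact: closX.
  apply: closed_span_weaken (closX t b) => q; lia.
have Z'2 t : square_integrable P (Z' t).
  by move=> i; rewrite component_dot; case: (closZ' t (delta_mx 0 i)).
have d2 t b := dot_Lfun2 b (X2 t).
have d2' t b := dot_Lfun2 b (Z'2 t).
have orthX t b h c : \int[P]_w (dot b (Z' t) w * dot c (X (t + 1 + h%:Z)) w) = 0.
  elim: h c => [|h IH] c.
    (* The normal equations of the regression. *)
    rewrite addr0; have -> : \int[P]_w (dot b (Z' t) w * dot c (X (t + 1)) w) =
      \int[P]_w ((dot b (X t) w + dot (- (b *m Phi')) (X (t + 1)) w) *
        dot c (X (t + 1)) w) by apply: eq_Rintegral => w _; rewrite dotZ'.
    rewrite RintegralMD_l// !second_moment_dot// G1E -hGamma0.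
    have -> : - (b *m Phi') *m Gamma0 *m c^T = - (b *m Gamma1 *m c^T).
      by rewrite /Phi' !mulNmx -!mulmxA (mulmxA (invmx _)) mulVmx// mul1mx.
    by rewrite [X in _ + X]mxE subrr.
  have E : t + 1 + h.+1%:Z - 1 = t + 1 + h%:Z by lia.
  have -> : \int[P]_w (dot b (Z' t) w * dot c (X (t + 1 + h.+1%:Z)) w) =
    \int[P]_w ((dot (c *m Phi) (X (t + 1 + h%:Z)) w + dot c (Z (t + 1 + h.+1%:Z)) w)
       * dot b (Z' t) w).
    apply: ae_eq_Rintegral.
    - by apply: measurable_funM; exact: Lfun_measurable.
    - apply: measurable_funM; last exact: Lfun_measurable.
      apply: measurable_funD; first exact: Lfun_measurable.
      by apply: Lfun_measurable; exact: dot_Lfun2.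
    - apply: filterS (eqX (t + 1 + h.+1%:Z)) => w Xw.
      by rewrite mulrC /dot Xw E mulmxDr mulmxA [in LHS]mxE.
  have dz := dot_Lfun2 c (Z2 (t + 1 + h.+1%:Z)).
  rewrite RintegralMD_l// RintegralMC IH add0r RintegralMC.
  by apply: (closed_span_orth Z2 indepZ gaussZ _ (closZ' t b)); rewrite -ltNge; lia.
have orthZ' t s b c : t < s -> \int[P]_w (dot b (Z' t) w * dot c (Z' s) w) = 0.
  move=> ts; have [h hE] : exists h : nat, s = t + 1 + h%:Z.
    by exists `|(s - t - 1)%R|%N; lia.
  rewrite RintegralMC.
  have -> : \int[P]_w (dot c (Z' s) w * dot b (Z' t) w) =
    \int[P]_w ((dot c (X s) w + dot (- (c *m Phi')) (X (s + 1)) w) * dot b (Z' t) w).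
    by apply: eq_Rintegral => w _; rewrite dotZ'.
  rewrite RintegralMD_l// RintegralMC [X in _ + X]RintegralMC hE orthX.
  have -> : t + 1 + h%:Z + 1 = t + 1 + h.+1%:Z by lia.
  by rewrite orthX addr0.
have closZ'T t i : closed_span P Z predT (component (Z' t) i).
  by rewrite component_dot; apply: closed_span_weaken (closZ' t _).
have closXT t i : closed_span P Z predT (component (X t) i).
  by rewrite component_dot; apply: closed_span_weaken (closX t _).
(* The variance of b Z'_t is the same for all t. *)
have sq t b : \int[P]_w (dot b (Z' t) w ^+ 2) = (b *m Gamma0 *m b^T) 0 0 +
    ((- (b *m Phi')) *m Gamma0 *m (- (b *m Phi'))^T) 0 0 +
    2 * (b *m Gamma1 *m (- (b *m Phi'))^T) 0 0.
  have -> : \int[P]_w (dot b (Z' t) w ^+ 2) =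
      \int[P]_w ((dot b (X t) w + dot (- (b *m Phi')) (X (t + 1)) w) ^+ 2).
    by apply: eq_Rintegral => w _; rewrite dotZ'.
  rewrite Rintegral_sqrD//.
  have -> : \int[P]_w (dot b (X t) w ^+ 2) = (b *m Gamma0 *m b^T) 0 0.
    by rewrite (hGamma0 t) -second_moment_dot//; apply: eq_Rintegral.
  have -> : \int[P]_w (dot (- (b *m Phi')) (X (t + 1)) w ^+ 2) =
      ((- (b *m Phi')) *m Gamma0 *m (- (b *m Phi'))^T) 0 0.
    by rewrite (hGamma0 (t + 1)) -second_moment_dot//; apply: eq_Rintegral.
  by rewrite second_moment_dot// G1E.
exists Phi', Z'; split; last 2 first.
- by move=> t; apply: aeW => w; rewrite /Z' addrC subrK.
- move=> t i ti A B bA bB.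
  have [h hE] : exists h : nat, i = t + 1 + h%:Z.
    by exists `|(i - t - 1)%R|%N; lia.
  apply: (@closed_span_orth_indep _ _ _ _ P Z Z2 indepZ gaussZ _ _
    (component (Z' t)) (component (X i))) => //.
  - by move=> j k; rewrite !component_dot hE orthX.
  - rewrite borel_cVE in bA.
    exact: (@preimage_sigma_of _ _ _ _ _ _ (component (Z' t)) (Z' t) id _ _ bA).
  - rewrite borel_cVE in bB.
    exact: (@preimage_sigma_of _ _ _ _ _ _ (component (X i)) (X i) id _ _ bB).
split=> //; last first.
- move=> t; apply/matrixP => i j; rewrite ord1 !mxE unlock.
  rewrite -[LHS]/(\int[P]_w component (Z' t) i w); apply: gaussian_mean.
  exact: (closed_span_gaussian Z2 indepZ gaussZ (closZ'T t i)).
- move=> s t B; rewrite borel_cVE => bB.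
  pose c i (v : 'cV[R]_K) := v i 0.
  have mc q i : measurable_fun setT (c i \o Z' q).
    exact: measurable_component (Z'2 q).
  have waveE a th q : \int[P]_w wave c a th (Z' q w) =
      \int[P]_w cos (1 * dot (\row_i a i) (Z' q) w + th).
    apply: eq_Rintegral => w _; rewrite /wave mul1r dotE; congr (cos (_ + _)).
    by apply: eq_bigr => i _; rewrite mxE.
  have same a th : \int[P]_w wave c a th (Z' s w) = \int[P]_w wave c a th (Z' t w).
    have [_ gs] := closed_span_gaussian Z2 indepZ gaussZ (closZ' s (\row_i a i)).
    have [_ gt] := closed_span_gaussian Z2 indepZ gaussZ (closZ' t (\row_i a i)).
    by rewrite !waveE gs gt !sq.
  by have [_ _ ->] := same_law (mc s) (mc t) same bB.
(* Mutual independence: peel off the earliest residual. *)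
move=> J; move: {2}#|` J| (erefl #|` J|) => n; elim: n J => [|n IH] J.
  move=> /cardfs0_eq -> B _; rewrite big_seq_fset0.
  rewrite (_ : \bigcap_(t in _) _ = setT) ?probability_setT//.
  by apply/seteqP; split => // w _ t /=; rewrite in_fset0.
move=> cJ B bB.
have [t tJ tmin] : exists2 t, t \in J & forall s, s \in J -> t <= s.
  by apply: fset_minimum; rewrite -cardfs_gt0 cJ.
have bB' s : s \in (J `\ t)%fset -> borel_cV (B s).
  by rewrite !inE => /andP[_]; exact: bB.
have := cJ; rewrite (cardfsD1 t) tJ => -[] /IH /(_ B bB') IHt.
rewrite (big_fsetD1 t tJ)/= -IHt.
have -> : \bigcap_(s in [set` J]) (Z' s @^-1` B s) = Z' t @^-1` B t `&`
    \bigcap_(s in [set` (J `\ t)%fset]) (Z' s @^-1` B s).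
  apply/seteqP; split => w /=.
    move=> H; split; first exact: H.
    by move=> s /=; rewrite !inE => /andP[_ sJ]; exact: H.
  move=> [H1 H2] s sJ; have [->//|st] := eqVneq s t.
  by apply: H2; rewrite /= !inE st.
pose g (k : (J `\ t)%fset * 'I_K) := component (Z' (val k.1)) k.2.
apply: (@closed_span_orth_indep _ _ _ _ P Z Z2 indepZ gaussZ _ _ (component (Z' t)) g) => //.
- by move=> k; exact: closZ'T.
- move=> i [[s sJ] j]; rewrite /g /= !component_dot orthZ'//.
  by move: sJ; rewrite !inE => /andP[st sJ]; rewrite lt_neqAle eq_sym st tmin.
- have := bB t tJ; rewrite borel_cVE => bBt.
  exact: (@preimage_sigma_of _ _ _ _ _ _ (component (Z' t)) (Z' t) id _ _ bBt).
rewrite bigcap_fset big_seq; apply: big_ind.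
- by have [S0 SC _] := sigma_algebra_sigma_of g; have := SC _ S0; rewrite setTD setC0.
- by move=> A C; apply: sigma_algebraI; exact: sigma_algebra_sigma_of.
- move=> s sJ; have := bB' s sJ; rewrite borel_cVE => bBs.
  by apply: (@preimage_sigma_of _ _ _ _ _ _ g (Z' s) (fun i => ([` sJ]%fset, i)) _ _ bBs).
Qed.
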